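(* Fix constants $\alpha,\beta>0$ and $s\in[0,1]$. Let $(G_1,G_2)\sim \mathrm{CSBM}\left(n,\frac{\alpha\log n}{n},\frac{\beta\log n}{n},s\right)$ with community labels $\boldsymbol{\sigma_*}$. Suppose that $$\left(1-(1-s)^2\right)\mathrm{D}_+(\alpha,\beta)>1$$ and that $$s^2\,\mathrm{T}_c(\alpha,\beta)+s(1-s)\,\mathrm{D}_+(\alpha,\beta)>1 .$$ Then there is an estimator $\widehat{\boldsymbol{\sigma}}=\widehat{\boldsymbol{\sigma}}(G_1,G_2)\in\{-1,+1\}^n$ such that $$\lim_{n\to\infty}\mathbb{P}\left(\mathsf{ov}(\widehat{\boldsymbol{\sigma}},\boldsymbol{\sigma_*})=1\right)=1 .$$
   Context: $\mathrm{SBM}(n,p,q)$: a random graph on vertex set $[n]=\{1,\dots,n\}$. Each vertex $i$ has a community label $\sigma_*(i)\in\{+1,-1\}$, i.i.d. uniform; $\boldsymbol{\sigma_*}=\{\sigma_*(i)\}_{i=1}^n$. Given the labels, edges are present independently over pairs of distinct vertices, $\{i,j\}$ with probability $p$ if $\sigma_*(i)=\sigma_*(j)$ and with probability $q$ otherwise. $\mathrm{CSBM}(n,p,q,s)$: generate a parent graph $G\sim\mathrm{SBM}(n,p,q)$ with labels $\boldsymbol{\sigma_*}$. Given $G$, let $G_1$ and $G_2'$ be two independent random subgraphs on $[n]$, each obtained by keeping every edge of $G$ independently with probability $s$ (non-edges stay non-edges). Let $\pi_*$ be a uniformly random permutation of $[n]$ independent of everything else, and let $G_2$ be obtained from $G_2'$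 by relabeling each vertex $i$ as $\pi_*(i)$. The output is $(G_1,G_2)$. Here $n$ is taken large enough that the edge probabilities are at most $1$; $\log$ is the natural logarithm. $\mathrm{D}_+(\alpha,\beta):=\left(\frac{\sqrt\alpha-\sqrt\beta}{\sqrt2}\right)^2=\frac{\alpha+\beta}{2}-\sqrt{\alpha\beta}$ and $\mathrm{T}_c(\alpha,\beta):=\frac{\alpha+\beta}{2}$. The overlap is $\mathsf{ov}(\widehat{\boldsymbol{\sigma}},\boldsymbol{\sigma_*}):=\frac1n\left|\sum_{i=1}^n\widehat\sigma(i)\sigma_*(i)\right|$. An estimator is a function of the observed pair $(G_1,G_2)$ (it may use the known parameters, but not $\boldsymbol{\sigma_*}$ or $\pi_*$). *)

(* Defs.v *)
From HB Require Import structures.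
From mathcomp Require Import all_boot all_order all_algebra all_fingroup.
From mathcomp Require Import all_classical all_reals all_analysis.

Set Implicit Arguments.
Unset Strict Implicit.
Unset Printing Implicit Defensive.

Import Order.TTheory GRing.Theory Num.Theory.
Import numFieldNormedType.Exports.

Local Open Scope ring_scope.

(* Unordered pairs of distinct vertices; a simple graph on 'I_n is the set of
   its edges. *)
Definition vpair (n : nat) := {e : {set 'I_n} | #|e| == 2%N}.
Definition graph (n : nat) := {set vpair n}.

Lemma vpair_map_subproof (n : nat) (pi : {perm 'I_n}) (e : vpair n) :
  #|pi @: val e| == 2%N.
Proof. by rewrite card_imset ?(valP e) //; exact: perm_inj. Qed.

Definition vpair_map (n : nat) (pi : {perm 'I_n}) (e : vpair n) : vpair n :=
  exist _ (pi @: val e) (vpair_map_subproof pi e).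

Definition relabel (n : nat) (pi : {perm 'I_n}) (G : graph n) : graph n :=
  [set vpair_map pi e | e in G].

(* [true] encodes the label +1 and [false] the label -1. *)
Definition labels (n : nat) := {ffun 'I_n -> bool}.
Definition spin (R : realType) (b : bool) : R := if b then 1 else -1.

Definition same_label (n : nat) (sigma : labels n) (e : vpair n) : bool :=
  [forall i in val e, forall j in val e, sigma i == sigma j].

Definition bernoulli_weight (R : realType) (p : R) (b : bool) : R :=
  if b then p else 1 - p.

(* Probability of G when each pair e is an edge independently with
   probability f e. *)
Definition indep_edges (R : realType) (n : nat) (f : vpair n -> R)
    (G : graph n) : R :=
  \prod_(e : vpair n) bernoulli_weight (f e) (e \in G).

Definition sbm_weight (R : realType) (n : nat) (p q : R) (sigma : labels n)
    (G : graph n) : R :=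
  indep_edges (fun e => if same_label sigma e then p else q) G.

Definition subsample_weight (R : realType) (n : nat) (s : R)
    (G H : graph n) : R :=
  indep_edges (fun e => if e \in G then s else 0) H.

(* Outcomes are (sigma, G, G1, G2', pi), with G the parent graph and G2' the
   second subgraph before relabeling by pi. *)
Definition csbm_outcome (n : nat) : predArgType :=
  (labels n * graph n * graph n * graph n * {perm 'I_n})%type.

Definition csbm_labels (n : nat) (w : csbm_outcome n) : labels n :=
  let: (sigma, _, _, _, _) := w in sigma.
Definition csbm_G1 (n : nat) (w : csbm_outcome n) : graph n :=
  let: (_, _, G1, _, _) := w in G1.
Definition csbm_G2 (n : nat) (w : csbm_outcome n) : graph n :=
  let: (_, _, _, G2', pi) := w in relabel pi G2'.

(* A probability mass function whenever p, q and s lie in [0, 1]. *)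
Definition csbm_pmf (R : realType) (n : nat) (p q s : R)
    (w : csbm_outcome n) : R :=
  let: (sigma, G, G1, G2', pi) := w in
  2^-1 ^+ n * sbm_weight p q sigma G *
  subsample_weight s G G1 * subsample_weight s G G2' * n`!%:R^-1.

Definition csbm_prob (R : realType) (n : nat) (p q s : R)
    (E : pred (csbm_outcome n)) : R :=
  \sum_(w : csbm_outcome n | E w) csbm_pmf p q s w.

Definition Dplus (R : realType) (alpha beta : R) : R :=
  ((Num.sqrt alpha - Num.sqrt beta) / Num.sqrt 2) ^+ 2.

Definition Tc (R : realType) (alpha beta : R) : R := (alpha + beta) / 2.

Definition overlap (R : realType) (n : nat) (tau sigma : labels n) : R :=
  n%:R^-1 * `|\sum_(i < n) spin R (tau i) * spin R (sigma i)|.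

(* p = a log n / n; it is at most 1 for all large n. *)
Definition log_density (R : realType) (a : R) (n : nat) : R :=
  a * ln n%:R / n%:R.

(* Main.v *)
Require Import Defs.
From HB Require Import structures.
From mathcomp Require Import all_boot all_order all_algebra all_fingroup.
From mathcomp Require Import all_classical all_reals all_analysis.
From mathcomp Require Import fintype finset.
From mathcomp Require Import ring lra zify.

Set Implicit Arguments.
Unset Strict Implicit.
Unset Printing Implicit Defensive.

Import Order.TTheory GRing.Theory Num.Theory.
Import numFieldNormedType.Exports.

Local Open Scope ring_scope.
Local Open Scope set_scope.

(** The estimator looks for a relabeling [tau] and a set [M] of vertices, as
large as possible, such that every vertex of [M] has at least 20 neighbours
inside [M] in the intersection of [G1] with the relabeled second graph. It then
maximizes over all labelings a likelihood in which pairs inside [M] are scored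
from the union of the two graphs, and all other pairs from [G1] alone.

Conditionally on the labels the indicators of distinct pairs are independent, so
every tail estimate is a Markov inequality for a product over pairs
([cond_prob_markov]) followed by a union or a first-moment bound. Four exceptional events have
vanishing probability.

A dense set is wrongly matched ([wrong_match_prob]). If the matching moves [d]
vertices of the set, at least [3 * d] edges have images under it that are again
edges, all these edges and images being distinct. Each such coincidence has
probability of order (ln n / n)^2, there are about [d * n] places for it, and
about n^(2 * d) ways to choose the moved vertices and their images: the total is
of order n^(- d) up to logarithms.

Call a vertex light when its degree in the intersection graph is below a
constant. Some vertex is adjacent to many light ones ([crowded_prob]), or the
light vertices are a positive fraction of all ([many_light_prob]). Outside these
events the heavy vertices form a dense set, so the maximal [M] contains them and
is correctly matched ([max_dense_heavy]).

The data favour a wrong labeling ([misled_prob]). Flipping the labels on a set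
[S] changes the likelihood on the pairs between [S] and its complement. The
square root of a likelihood ratio has as expectation a Bhattacharyya coefficient, which for a
pair scored from the union is close to exp (- (1 - (1 - s)^2) * Dplus * ln n / n).
If the endpoint in [S] is unmatched, hence light, common edges are essentially
forbidden at the pair, and the mean of the square root of the ratio for [G1],
restricted to the absence of a common edge, is close to
exp (- (s^2 * Tc + s * (1 - s) * Dplus) * ln n / n). By hypothesis both
coefficients of ln n / n exceed 1, so that each vertex of a small set [S] costs
a factor smaller than n^(- 1), which beats the number of choices of [S]; if [S]
is large, but has at most n / 2 vertices, the factor is at most about
n^(- 1 / 2), and this beats the 2^n choices of [S]. The pairs from a matched
vertex of [S] to an unmatched one outside [S] are scored from [G1] only; they
are few by the two preceding events ([score_max_misled]). *)

(** * Unordered pairs and cuts *)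

Lemma card_exists_le (T U : finType) (B : {set T}) (P : T -> U -> bool) m :
  {in B, forall v, (#|[set e | P v e]| <= m)%N} ->
  (#|[set e | [exists v in B, P v e]]| <= m * #|B|)%N.
Proof.
move=> Pm; have -> : [set e | [exists v in B, P v e]] =
    \bigcup_(v in B) [set e | P v e].
  apply/setP => e; rewrite inE.
  by apply/exists_inP/bigcupP => -[v vB]; rewrite ?inE => h; exists v; rewrite ?inE.
apply: (@leq_trans (\sum_(v in B) #|[set e | P v e]|)%N).
  elim/big_ind2: _ => [|x A y C xA yC|//]; first by rewrite cards0.
  by apply: leq_trans (leq_card_setU _ _) _; exact: leq_add.
by rewrite mulnC -sum_nat_const; apply: leq_sum.
Qed.


Section Pairs.
Variable n : nat.
Implicit Types (e : vpair n) (A C S : {set 'I_n}) (sigma : labels n).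

Definition touches e A : bool := [exists i in A, i \in val e].

Definition crosses e S : bool := touches e S && touches e (~: S).

Lemma vpairE e : exists i j, i != j /\ val e = [set i; j].
Proof. by have /cards2P[i [j [ij eE]]] := valP e; exists i, j. Qed.

Lemma touchesP e A : reflect (exists2 i, i \in val e & i \in A) (touches e A).
Proof.
by apply: (iffP exists_inP) => -[i]; exists i.
Qed.

Lemma touches_pair e A i j : val e = [set i; j] ->
  touches e A = (i \in A) || (j \in A).
Proof.
move=> eE; apply/touchesP/orP => [[x]|].
  by rewrite eE !inE => /orP[]/eqP-> ->; [left|right].
by case=> h; [exists i|exists j]; rewrite // eE !inE eqxx ?orbT.
Qed.

Lemma crosses_pair e S i j : val e = [set i; j] ->
  crosses e S = ((i \in S) != (j \in S)).
Proof.
by move=> eE; rewrite /crosses !(touches_pair _ eE) !inE; do 2!case: (_ \in S).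
Qed.

Lemma crossesC e S : crosses e (~: S) = crosses e S.
Proof. by rewrite /crosses setCK andbC. Qed.

Lemma same_label_pair sigma e i j : val e = [set i; j] ->
  same_label sigma e = (sigma i == sigma j).
Proof.
move=> eE; apply/forall_inP/eqP => [h|ij x].
  have iV : i \in val e by rewrite eE !inE eqxx.
  have jV : j \in val e by rewrite eE !inE eqxx orbT.
  by apply/eqP; move/forall_inP: (h i iV); apply.
rewrite eE !inE => xe; apply/forall_inP => y; rewrite !inE => ye.
by move: xe ye => /orP[]/eqP-> /orP[]/eqP->; rewrite ?eqxx ?ij.
Qed.

(** The labels enter the model through [same_label] only, and changing the
labels on [S] toggles it exactly on the cut of [S]. *)
Lemma same_label_flip sigma (tau : labels n) e S : S = [set i | tau i != sigma i] ->
  same_label tau e = same_label sigma e (+) crosses e S.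
Proof.
move=> ->; have [i [j [_ eE]]] := vpairE e.
rewrite !(same_label_pair _ eE) (crosses_pair _ eE) !inE.
by case: (tau i) (tau j) (sigma i) (sigma j) => [] [] [] [].
Qed.

Lemma card_touches2 A C : {in A, forall i, i \notin C} ->
  #|[set e | touches e A && touches e C]| = (#|A| * #|C|)%N.
Proof.
move=> dAC.
have AC i : i \in A -> i \in C -> False by move=> /dAC/negP.
rewrite -cardsX.
rewrite -(card_imset _ val_inj).
rewrite -(@card_in_imset _ _ (fun x : 'I_n * 'I_n => [set x.1; x.2])).
  apply: eq_card => X; apply/imsetP/imsetP => [[e]|[[i j]]].
    rewrite inE => /andP[/touchesP[i ie iA] /touchesP[j je jC]] ->.
    exists (i, j); rewrite ?inE ?iA ?jC //=; apply/esym/eqP.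
    have ij : i != j by apply/eqP => ij; apply: (AC i) => //; rewrite ij.
    rewrite eqEcard cards2 ij (eqP (valP e)) leqnn andbT.
    by apply/subsetP => x; rewrite !inE => /orP[]/eqP->.
  rewrite inE /= => /andP[iA jC] ->.
  have ij : i != j by apply/eqP => ij; apply: (AC i) => //; rewrite ij.
  have ce : #|[set i; j]| == 2%N by rewrite cards2 ij.
  pose e : vpair n := exist _ [set i; j] ce.
  by exists e; rewrite // inE !(@touches_pair e _ i j) // iA jC orbT.
move=> [i j] [k l]; rewrite !inE /= => /andP[iA jC] /andP[kA lC] E.
have : i \in [set k; l] by rewrite -E !inE eqxx.
have : j \in [set k; l] by rewrite -E !inE eqxx orbT.
rewrite !inE => /orP[/eqP jk|/eqP->].
  by case: (AC j) => //; rewrite jk.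
case/orP => [/eqP->//|/eqP il]; by case: (AC i) => //; rewrite il.
Qed.

Lemma card_touches_le A : (#|[set e | touches e A]| <= #|A| * n)%N.
Proof.
rewrite -[X in (_ <= _ * X)%N]card_ord -cardsT -cardsX.
rewrite -(card_imset _ val_inj).
apply: leq_trans (leq_imset_card (fun x : 'I_n * 'I_n => [set x.1; x.2]) _).
apply/subset_leq_card/subsetP => X /imsetP[e]; rewrite inE => + ->.
have [i [j [_ eE]]] := vpairE e.
rewrite (touches_pair _ eE) => /orP[] h; apply/imsetP.
  by exists (i, j); rewrite ?inE ?h.
by exists (j, i); rewrite ?inE ?h //= [val e]eE setUC.
Qed.

End Pairs.

(** * The two subgraphs as a product space over pairs *)

Lemma sum_pair (R : realType) (A B : finType) (F : A * B -> R) :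
  \sum_x F x = \sum_a \sum_b F (a, b).
Proof. by rewrite pair_bigA; apply: eq_bigr => -[]. Qed.

Lemma sum_set_prod (R : realType) (T : finType) (F : T -> bool -> R) :
  \sum_(G : {set T}) \prod_e F e (e \in G) = \prod_e (F e true + F e false).
Proof.
rewrite bigA_distr; apply: eq_bigr => G _; apply: eq_bigr => e _.
by case: (e \in G).
Qed.

Section PairSpace.
Variables (R : realType) (n : nat).
Implicit Types (p q s : R) (sigma : labels n) (G H X Y : graph n).

Definition edge_prob p q sigma (e : vpair n) : R :=
  if same_label sigma e then p else q.

(** Joint law of the two indicators of a pair, the parent edge being integrated
out. *)
Definition pair_weight p s (b1 b2 : bool) : R :=
  p * (bernoulli_weight s b1 * bernoulli_weight s b2) +
  (1 - p) * (~~ b1 && ~~ b2)%:R.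

Definition graphs_weight p q s sigma X Y : R :=
  \prod_e pair_weight (edge_prob p q sigma e) s (e \in X) (e \in Y).

(** The parent graph is integrated out, and the second subgraph is taken before
relabeling. *)
Definition cond_prob p q s sigma (E : graph n -> graph n -> Prop) : R :=
  \sum_(x : graph n * graph n | `[< E x.1 x.2 >]) graphs_weight p q s sigma x.1 x.2.

Lemma sum_graphs_prod (F : vpair n -> bool -> bool -> R) :
  \sum_(x : graph n * graph n) \prod_e F e (e \in x.1) (e \in x.2) =
  \prod_e \sum_(b1 : bool) \sum_(b2 : bool) F e b1 b2.
Proof.
rewrite (sum_pair (fun x : graph n * graph n => _)) /=.
under eq_bigr => X _ do rewrite (sum_set_prod (fun e b => F e (e \in X) b)).
rewrite (sum_set_prod (fun e b => F e b true + F e b false)).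
by apply: eq_bigr => e _; rewrite !big_bool.
Qed.

Lemma sum_parent p q s sigma X Y :
  \sum_G sbm_weight p q sigma G * subsample_weight s G X *
         subsample_weight s G Y = graphs_weight p q s sigma X Y.
Proof.
under eq_bigr => G _.
  rewrite /sbm_weight /subsample_weight /indep_edges -!big_split /=.
  over.
pose F (e : vpair n) g := bernoulli_weight (edge_prob p q sigma e) g *
  bernoulli_weight (if g then s else 0) (e \in X) *
  bernoulli_weight (if g then s else 0) (e \in Y).
rewrite (sum_set_prod F); apply: eq_bigr => e _; rewrite /F /pair_weight.
by rewrite /bernoulli_weight; case: (e \in X); case: (e \in Y) => /=; ring.
Qed.

Section Valid.
Variables (p q s : R).
Hypotheses (p01 : 0 <= p <= 1) (q01 : 0 <= q <= 1) (s01 : 0 <= s <= 1).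

Lemma edge_prob01 sigma e : 0 <= edge_prob p q sigma e <= 1.
Proof. by rewrite /edge_prob; case: ifP. Qed.

Lemma bernoulli_weight_ge0 (r : R) b : 0 <= r <= 1 -> 0 <= bernoulli_weight r b.
Proof. by case/andP => r0 r1; case: b => //=; rewrite subr_ge0. Qed.

Lemma pair_weight_ge0 (r : R) b1 b2 : 0 <= r <= 1 -> 0 <= pair_weight r s b1 b2.
Proof.
move=> /andP[r0 r1]; rewrite addr_ge0 ?mulr_ge0 ?bernoulli_weight_ge0 //.
by rewrite subr_ge0.
Qed.

Lemma graphs_weight_ge0 sigma X Y : 0 <= graphs_weight p q s sigma X Y.
Proof. by apply: prodr_ge0 => e _; exact/pair_weight_ge0/edge_prob01. Qed.

Lemma sum_pair_weight (r : R) :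
  \sum_(b1 : bool) \sum_(b2 : bool) pair_weight r s b1 b2 = 1.
Proof. by rewrite !big_bool /pair_weight /bernoulli_weight /=; ring. Qed.

Lemma sum_graphs_weight sigma :
  \sum_(x : graph n * graph n) graphs_weight p q s sigma x.1 x.2 = 1.
Proof.
rewrite (sum_graphs_prod
  (fun e b1 b2 => pair_weight (edge_prob p q sigma e) s b1 b2)).
by rewrite big1 // => e _; exact: sum_pair_weight.
Qed.

Lemma csbm_pmf_ge0 (w : csbm_outcome n) : 0 <= csbm_pmf p q s w.
Proof.
move: w => [[[[sigma G] X] Y] pi]; rewrite /csbm_pmf.
have ge0 (f : vpair n -> R) H : (forall e, 0 <= f e <= 1) -> 0 <= indep_edges f H.
  by move=> h; apply: prodr_ge0 => e _; exact: bernoulli_weight_ge0.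
rewrite !mulr_ge0 ?exprn_ge0 ?invr_ge0 ?ler0n //; apply: ge0 => e.
- by case: ifP.
- by case: ifP => // _; rewrite lexx ler01.
- by case: ifP => // _; rewrite lexx ler01.
Qed.

Lemma sum_csbm_pmf (F : labels n -> graph n -> graph n -> R) :
  \sum_(w : csbm_outcome n)
     (let: (sigma, _, X, Y, _) := w in F sigma X Y) * csbm_pmf p q s w =
  \sum_sigma 2^-1 ^+ n *
     \sum_(x : graph n * graph n) F sigma x.1 x.2 * graphs_weight p q s sigma x.1 x.2.
Proof.
rewrite !sum_pair; apply: eq_bigr => sigma _.
rewrite exchange_big /= mulr_sumr sum_pair; apply: eq_bigr => X _.
rewrite exchange_big /=; apply: eq_bigr => Y _.
rewrite -sum_parent !mulr_sumr; apply: eq_bigr => G _.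
rewrite sumr_const card_Sn -mulr_natl.
have : n`!%:R != 0 :> R by rewrite pnatr_eq0 -lt0n fact_gt0.
by move=> ?; field.
Qed.

(** The labels and the relabeling are averaged out, so it is enough to bound the
probability of failure for each labeling. *)
Lemma csbm_prob_bounds (E : pred (csbm_outcome n)) (B : R)
    (bad : labels n -> graph n -> graph n -> Prop) :
  (forall sigma G X Y pi, ~ bad sigma X Y -> E (sigma, G, X, Y, pi)) ->
  (forall sigma, cond_prob p q s sigma (bad sigma) <= B) ->
  1 - B <= csbm_prob p q s E <= 1.
Proof.
move=> badE badB.
have avg (c : R) : \sum_(sigma : labels n) 2^-1 ^+ n * c = c.
  rewrite sumr_const card_ffun card_bool card_ord -[LHS]mulr_natl natrX mulrA -exprMn.
  by rewrite divff ?expr1n ?mul1r // pnatr_eq0.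
have tot : \sum_(w : csbm_outcome n) csbm_pmf p q s w = 1.
  have := sum_csbm_pmf (fun _ _ _ => 1).
  under eq_bigr => -[[[[sigma G] X] Y] pi] _ do rewrite mul1r.
  move=> ->; rewrite -[RHS]avg; apply: eq_bigr => sigma _; congr (_ * _).
  under eq_bigr do rewrite mul1r.
  exact: sum_graphs_weight.
apply/andP; split; last first.
  rewrite -tot /csbm_prob [leRHS](bigID E) /= lerDl.
  by apply: sumr_ge0 => w _; exact: csbm_pmf_ge0.
rewrite lerBlDr -tot /csbm_prob (bigID E) /= lerD2l.
apply: (@le_trans _ _ (\sum_(w : csbm_outcome n)
   (let: (sigma, _, X, Y, _) := w in (`[< bad sigma X Y >])%:R) *
     csbm_pmf p q s w)).
  rewrite big_mkcond /=; apply: ler_sum => -[[[[sigma G] X] Y] pi] _.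
  have := csbm_pmf_ge0 (sigma, G, X, Y, pi).
  case: asboolP => [_|/badE ->]; first by rewrite mul1r; case: ifP.
  by rewrite mul0r.
rewrite (sum_csbm_pmf (fun sigma X Y => (`[< bad sigma X Y >])%:R)).
rewrite -[leRHS]avg; apply: ler_sum => sigma _.
rewrite ler_wpM2l ?exprn_ge0 ?invr_ge0 //; apply: le_trans (badB sigma).
rewrite /cond_prob [leRHS]big_mkcond.
by apply: ler_sum => x _; case: ifP; rewrite ?mul1r ?mul0r.
Qed.

(** Markov's inequality for a functional that factorizes over pairs: by
independence its expectation is a product of one-pair expectations. *)
Lemma cond_prob_markov sigma (E : graph n -> graph n -> Prop)
    (phi : vpair n -> bool -> bool -> R) (c : R) :
  (forall e b1 b2, 0 <= phi e b1 b2) -> 0 <= c ->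
  (forall X Y, E X Y -> 1 <= c * \prod_e phi e (e \in X) (e \in Y)) ->
  cond_prob p q s sigma E <=
  c * \prod_e \sum_(b1 : bool) \sum_(b2 : bool)
     pair_weight (edge_prob p q sigma e) s b1 b2 * phi e b1 b2.
Proof.
move=> phi0 c0 Ephi; rewrite -(sum_graphs_prod
  (fun e b1 b2 => pair_weight (edge_prob p q sigma e) s b1 b2 * phi e b1 b2)).
rewrite mulr_sumr /cond_prob big_mkcond; apply: ler_sum => -[X Y] _ /=.
rewrite big_split /= -/(graphs_weight p q s sigma X Y) mulrCA.
have w0 := graphs_weight_ge0 sigma X Y.
case: asboolP => [/Ephi h|_]; first by rewrite ler_peMr.
by rewrite !mulr_ge0 // prodr_ge0.
Qed.

Lemma cond_prob_sub sigma (E0 E : graph n -> graph n -> Prop) :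
  (forall X Y, E0 X Y -> E X Y) -> cond_prob p q s sigma E0 <= cond_prob p q s sigma E.
Proof.
move=> E0E; rewrite /cond_prob big_mkcond [leRHS]big_mkcond.
apply: ler_sum => -[X Y] _ /=; have w0 := graphs_weight_ge0 sigma X Y.
case: asboolP => [/E0E h|_]; last by case: ifP.
by case: asboolP.
Qed.

Lemma cond_prob_or sigma (E E' : graph n -> graph n -> Prop) :
  cond_prob p q s sigma (fun X Y => E X Y \/ E' X Y) <=
  cond_prob p q s sigma E + cond_prob p q s sigma E'.
Proof.
rewrite /cond_prob big_mkcond [X in _ <= X + _]big_mkcond.
rewrite [X in _ <= _ + X]big_mkcond -big_split.
apply: ler_sum => -[X Y] _ /=; have w0 := graphs_weight_ge0 sigma X Y.
case: asboolP => [[h|h]|_]; last by rewrite addr_ge0 //; case: ifP.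
  by case: asboolP => // _; rewrite lerDl; case: ifP.
by case: (asboolP (E' X Y)) => // _; rewrite lerDr; case: ifP.
Qed.

Lemma cond_prob_count (I : finType) (P : pred I) sigma m
    (E0 : graph n -> graph n -> Prop) (E : I -> graph n -> graph n -> Prop) :
  (forall X Y, E0 X Y -> (m <= #|[set i | P i && `[< E i X Y >]]|)%N) ->
  m%:R * cond_prob p q s sigma E0 <= \sum_(i | P i) cond_prob p q s sigma (E i).
Proof.
move=> E0E; rewrite /cond_prob mulr_sumr big_mkcond /=.
under [leRHS]eq_bigr do rewrite big_mkcond /=.
rewrite exchange_big /=; apply: ler_sum => -[X Y] _ /=.
have w0 := graphs_weight_ge0 sigma X Y.
rewrite -big_mkcondr /= sumr_const.
case: asboolP => [/E0E|_]; last by rewrite mulrn_wge0.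
rewrite mulr_natl => h; rewrite -mulr_natl -[leRHS]mulr_natl ler_wpM2r // ler_nat.
by apply: leq_trans h _; apply: eq_leq; apply: eq_card => i; rewrite inE.
Qed.

Lemma cond_prob_union (I : finType) (P : pred I) sigma
    (E0 : graph n -> graph n -> Prop) (E : I -> graph n -> graph n -> Prop) :
  (forall X Y, E0 X Y -> exists2 i, P i & E i X Y) ->
  cond_prob p q s sigma E0 <= \sum_(i | P i) cond_prob p q s sigma (E i).
Proof.
move=> E0E; rewrite -[leLHS]mul1r.
apply: (@cond_prob_count I P sigma 1) => X Y /E0E[i Pi Ei]; rewrite card_gt0.
apply/set0Pn; exists i.
by rewrite inE Pi; apply/asboolP.
Qed.

End Valid.
End PairSpace.

(** * Dense matched sets *)

Section Alignment.
Variable n : nat.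
Implicit Types (X Y : graph n) (M : {set 'I_n}) (e : vpair n) (rho : {perm 'I_n}).

Lemma mem_relabel rho Y e : (e \in relabel rho Y) = (vpair_map rho^-1 e \in Y).
Proof.
have K : cancel (@vpair_map n rho^-1) (@vpair_map n rho).
  move=> f; apply: val_inj; rewrite /= -imset_comp.
  by rewrite (eq_imset _ (permKV rho)) imset_id.
have K' : cancel (@vpair_map n rho) (@vpair_map n rho^-1).
  move=> f; apply: val_inj; rewrite /= -imset_comp.
  by rewrite (eq_imset _ (permK rho)) imset_id.
apply/imsetP/idP => [[f fY ->]|h]; first by rewrite K'.
by exists (vpair_map rho^-1 e).
Qed.

Lemma relabelM rho rho' Y : relabel rho' (relabel rho Y) = relabel (rho * rho')%g Y.
Proof.
apply/setP => e; rewrite !mem_relabel invMg.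
suff -> : vpair_map rho^-1 (vpair_map rho'^-1 e) = vpair_map (rho'^-1 * rho^-1) e.
  by [].
apply: val_inj; rewrite /= -imset_comp; apply: eq_imset => i /=.
by rewrite permM.
Qed.

Lemma mem_relabel_fix rho Y e :
  {in val e, rho =1 id} -> (e \in relabel rho Y) = (e \in Y).
Proof.
move=> fix_e; rewrite mem_relabel; suff -> : vpair_map rho^-1 e = e by [].
apply: val_inj; rewrite /= -[RHS]imset_id; apply: eq_in_imset => i ie.
by rewrite -{1}(fix_e i ie) permK.
Qed.

Lemma relabel1 Y : relabel 1 Y = Y.
Proof. by apply/setP => e; rewrite mem_relabel_fix // => i _; rewrite perm1. Qed.

Definition inner_deg X M (v : 'I_n) : nat :=
  #|[set e in X | (v \in val e) && (val e \subset M)]|.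

Definition kdense k X M : bool := [forall v in M, (k <= inner_deg X M v)%N].

Lemma kdense0 k X : kdense k X set0.
Proof. by apply/forall_inP => v; rewrite inE. Qed.

Lemma inner_degS X M M' v : M \subset M' -> (inner_deg X M v <= inner_deg X M' v)%N.
Proof.
move=> MM'; apply/subset_leq_card/subsetP => e; rewrite !inE.
by case/and3P => -> -> /subset_trans->.
Qed.

Lemma kdenseU k X M M' : kdense k X M -> kdense k X M' -> kdense k X (M :|: M').
Proof.
move=> /forall_inP dM /forall_inP dM'; apply/forall_inP => v; rewrite inE.
case/orP => [/dM|/dM'] /leq_trans; apply; apply: inner_degS.
  exact: subsetUl.
exact: subsetUr.
Qed.

Definition light K X Y : {set 'I_n} :=
  [set v | (#|[set e in X :&: Y | v \in val e]| < K)%N].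

Lemma card_common_touches K X Y (T : {set 'I_n}) (Q : pred (vpair n)) :
  T \subset light K X Y ->
  (#|[set e in X :&: Y | touches e T && Q e]| <= K * #|T|)%N.
Proof.
move=> TL; apply: leq_trans (@card_exists_le _ _ T
  (fun v e => (e \in X :&: Y) && (v \in val e)) K _).
  apply/subset_leq_card/fintype.subsetP => e; rewrite !inE.
  case/and3P => eXY /touchesP[v ve vT] _.
  by apply/exists_inP; exists v; rewrite // eXY.
move=> v /(fintype.subsetP TL); rewrite inE => /ltnW; congr (_ <= _)%N.
Qed.

Definition light_nbrs K X Y v : {set vpair n} :=
  [set e in X :|: Y | (v \in val e) && touches e (light K X Y :\ v)].

Definition wrong_match k X Y : Prop :=
  exists rho M, kdense k (X :&: relabel rho Y) M /\ exists2 i, i \in M & rho i != i.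

Definition crowded c K X Y : Prop := exists v, (c <= #|light_nbrs K X Y v|)%N.

(** Few edges join a vertex to the light vertices, so discarding the latter
leaves degrees at least [k] in the intersection graph. *)
Lemma kdense_heavy k c X Y : ~ crowded c (k + c) X Y ->
  kdense k (X :&: Y) (~: light (k + c) X Y).
Proof.
set L := light _ _ _ => ncr; apply/forall_inP => v; rewrite !inE -leqNgt => degv.
have nb : (#|light_nbrs (k + c) X Y v| < c)%N.
  by rewrite ltnNge; apply/negP => h; apply: ncr; exists v.
suff : (#|[set e in X :&: Y | v \in val e]| <=
        inner_deg (X :&: Y) (~: L) v + #|light_nbrs (k + c) X Y v|)%N.
  by move: degv nb; lia.
apply: leq_trans (leq_card_setU _ _); apply/subset_leq_card/subsetP => e.
rewrite !inE => /andP[/andP[eX eY] ve]; rewrite eX eY ve /=.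
case: (boolP (_ \subset _)) => //= /subsetPn[w we wL].
apply/touchesP; exists w => //; rewrite !inE in wL *; rewrite -leqNgt -ltnNge in wL.
by rewrite wL andbT; apply: contraTneq degv => <-; rewrite -ltnNge.
Qed.

(** The union of two correctly matched dense sets is dense, so heavy vertices
missing from [M] could be added to it. *)
Lemma max_dense_heavy k c X Y rho M :
  ~ wrong_match k X Y -> ~ crowded c (k + c) X Y ->
  kdense k (X :&: relabel rho Y) M ->
  (forall M', kdense k (X :&: Y) M' -> (#|M'| <= #|M|)%N) ->
  {in M, rho =1 id} /\ ~: M \subset light (k + c) X Y.
Proof.
move=> nwm ncr dM maxM.
have idM : {in M, rho =1 id}.
  by move=> i iM; apply/eqP/negPn/negP => h; apply: nwm; exists rho, M; split=> //; exists i.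
split=> //.
have dM' : kdense k (X :&: Y) M.
  apply/forall_inP => v /(forall_inP dM v); congr (_ <= _)%N; apply: eq_card => e.
  rewrite !inE; case: (boolP (_ \subset _)) => [eM|]; last by rewrite !andbF.
  by rewrite mem_relabel_fix // => i /(fintype.subsetP eM)/idM.
have /maxM := kdenseU dM' (kdense_heavy ncr).
rewrite (geq_leqif (subset_leqif_cards (subsetUl _ _))) => /eqP ME.
by rewrite -setCS setCK [in X in _ \subset X]ME subsetUr.
Qed.

End Alignment.

(** * Maximum likelihood with a partial matching *)

Definition union_rate (R : realType) (s : R) : R := 1 - (1 - s) ^+ 2.

Section Likelihood.
Variables (R : realType) (n : nat).
Implicit Types (p q s t : R) (sigma tau : labels n) (X Y : graph n).
Implicit Types (M S B : {set 'I_n}) (e : vpair n).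

Definition edge_lik p q t sigma e b : R :=
  bernoulli_weight (t * edge_prob p q sigma e) b.

(** Inside the matched set both subgraphs are visible and their union is used;
all other pairs are seen in [G1] only. *)
Definition score p q s M X Y sigma : R :=
  \prod_(e : vpair n) (if val e \subset M
           then edge_lik p q (union_rate s) sigma e ((e \in X) || (e \in Y))
           else edge_lik p q s sigma e (e \in X)).

(** Flipping the label of one endpoint of a pair swaps [p] and [q]. *)
Definition lik_ratio p q t sigma e b : R :=
  edge_lik q p t sigma e b / edge_lik p q t sigma e b.

Definition cut_ratio p q s B sigma e (x y : bool) : R :=
  if touches e B then lik_ratio p q s sigma e x
  else lik_ratio p q (union_rate s) sigma e (x || y).

(** The vertices of [B] are those vertices of [S] that have been left unmatched:
they are judged from [G1] alone, and they have few edges in the intersection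
graph. The factor [Lam] pays for the pairs between a matched vertex of [S] and
an unmatched one outside [S], which are scored from [G1] but counted here as if
the union were known. *)
Definition misled p q s (K : nat) (Lam : R) sigma X Y : Prop :=
  exists S B, [/\ B \subset S, (0 < #|S|)%N, (#|S|.*2 <= n)%N,
    (#|[set e in X :&: Y | touches e B && crosses e S]| <= K * #|B|)%N &
    1 <= Lam ^+ #|S :\: B| *
         \prod_(e | crosses e S) cut_ratio p q s B sigma e (e \in X) (e \in Y)].

Section Ratios.
Variables (p q s : R).
Hypotheses (p0 : 0 < p) (p1 : p < 1) (q0 : 0 < q) (q1 : q < 1).
Hypotheses (s0 : 0 < s) (s1 : s <= 1).

Lemma union_rate_gt0 : 0 < union_rate s.
Proof.
have -> : union_rate s = s * (2 - s) by rewrite /union_rate; ring.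
by rewrite mulr_gt0 // subr_gt0; move: s1; lra.
Qed.

Lemma union_rate_le1 : union_rate s <= 1.
Proof. by rewrite /union_rate lerBlDr lerDl sqr_ge0. Qed.

Lemma bernoulli_weight_gt0 (r : R) b : 0 < r -> r < 1 -> 0 < bernoulli_weight r b.
Proof. by case: b => //=; rewrite subr_gt0. Qed.

Lemma edge_lik_gt0 t sigma e b : 0 < t -> t <= 1 ->
  0 < edge_lik p q t sigma e b /\ 0 < edge_lik q p t sigma e b.
Proof.
move=> t0 t1; split; apply: bernoulli_weight_gt0; rewrite /edge_prob; case: ifP => _;
  by move: p0 p1 q0 q1 => *; nra.
Qed.

Lemma lik_ratio_gt0 t sigma e b : 0 < t -> t <= 1 -> 0 < lik_ratio p q t sigma e b.
Proof. by move=> t0 t1; case: (edge_lik_gt0 sigma e b t0 t1) => h h'; exact: divr_gt0. Qed.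

Lemma cut_ratio_gt0 B sigma e x y : 0 < cut_ratio p q s B sigma e x y.
Proof.
rewrite /cut_ratio; case: ifP => _; apply: lik_ratio_gt0 => //.
  exact: union_rate_gt0.
exact: union_rate_le1.
Qed.

Lemma score_gt0 M X Y sigma : 0 < score p q s M X Y sigma.
Proof.
apply: prodr_gt0 => e _; case: ifP => _.
  by case: (edge_lik_gt0 sigma e ((e \in X) || (e \in Y)) union_rate_gt0 union_rate_le1).
by case: (edge_lik_gt0 sigma e (e \in X) s0 s1).
Qed.

Lemma score_flip M X Y sigma tau S :
  (forall e, same_label tau e = same_label sigma e (+) crosses e S) ->
  score p q s M X Y tau = score p q s M X Y sigma *
    \prod_(e : vpair n | crosses e S)
       (if val e \subset M
        then lik_ratio p q (union_rate s) sigma e ((e \in X) || (e \in Y))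
        else lik_ratio p q s sigma e (e \in X)).
Proof.
move=> flip; rewrite [X in _ * X]big_mkcond -big_split /=.
have tauE e : edge_prob p q tau e =
    if crosses e S then edge_prob q p sigma e else edge_prob p q sigma e.
  by rewrite /edge_prob flip; case: (same_label sigma e); case: crosses.
apply: eq_bigr => e _; rewrite /lik_ratio /edge_lik tauE.
case: (crosses e S); last by rewrite mulr1.
have h := edge_lik_gt0 sigma e ((e \in X) || (e \in Y)) union_rate_gt0 union_rate_le1.
have h' := edge_lik_gt0 sigma e (e \in X) s0 s1.
case: ifP => _; rewrite [RHS]mulrC divfK //; apply: lt0r_neq0.
  by case: h.
by case: h'.
Qed.

Variables (C0 kap : R).
Hypotheses (pC0 : p <= C0 * q) (qC0 : q <= C0 * p).
Hypotheses (kapE : 1 <= kap * ((1 - p) * (1 - q))).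

Lemma kap_ge1 : 1 <= kap.
Proof.
have u0 : 0 < (1 - p) * (1 - q) by rewrite mulr_gt0 // subr_gt0.
have u1 : (1 - p) * (1 - q) <= 1 by move: p0 p1 q0 q1 => *; nra.
have k0 : 0 < kap by rewrite -(pmulr_lgt0 _ u0) (lt_le_trans ltr01).
by apply: le_trans kapE _; rewrite ler_piMr // ltW.
Qed.

Lemma C0_ge1 : 1 <= C0.
Proof.
have C00 : 0 < C0 by rewrite -(pmulr_lgt0 _ q0) (lt_le_trans p0).
have : 1 * p <= C0 ^+ 2 * p.
  by rewrite mul1r expr2 -mulrA; apply: le_trans pC0 _; rewrite ler_wpM2l // ltW.
by rewrite ler_pM2r // expr_ge1 // ltW.
Qed.

(** The price of judging a pair from [G1] instead of the union. It is bounded if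
the pair carries an edge, and [kap], which can be taken close to 1, if not. *)
Lemma lik_ratio_le_union sigma e (x y : bool) :
  lik_ratio p q s sigma e x <=
  lik_ratio p q (union_rate s) sigma e (x || y) * (C0 ^+ (x || y) * kap).
Proof.
have u0 := union_rate_gt0; have u1 := union_rate_le1; move: s0 s1 => s0' s1'.
have k1 := kap_ge1; have c1 := C0_ge1.
rewrite /lik_ratio /edge_lik.
have : (edge_prob p q sigma e = p /\ edge_prob q p sigma e = q) \/
       (edge_prob p q sigma e = q /\ edge_prob q p sigma e = p).
  by rewrite /edge_prob; case: same_label; [left|right].
have main (a b : R) : 0 < a -> a < 1 -> 0 < b -> b < 1 -> a <= C0 * b ->
    1 <= kap * ((1 - a) * (1 - b)) ->
    bernoulli_weight (s * b) x / bernoulli_weight (s * a) x <=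
    bernoulli_weight (union_rate s * b) (x || y) /
    bernoulli_weight (union_rate s * a) (x || y) * (C0 ^+ (x || y) * kap).
  move=> a0 a1 b0 b1 ab kab; set u := union_rate s in u0 u1 *.
  have sa1 : s * a < 1 by nra.
  have sb1 : s * b < 1 by nra.
  have ua1 : u * a < 1 by nra.
  have ub1 : u * b < 1 by nra.
  case: x => /=.
    rewrite expr1 ler_pdivrMr ?mulr_gt0 //.
    have -> : u * b / (u * a) * (C0 * kap) * (s * a) = s * b * (C0 * kap).
      by field; rewrite !lt0r_neq0.
    by rewrite ler_peMr ?mulr_ege1 // mulr_ge0 // ltW.
  have sa : 1 - a <= 1 - s * a by rewrite lerD2l lerN2 ler_piMl // ltW.
  have ub : 1 - b <= 1 - u * b by rewrite lerD2l lerN2 ler_piMl // ltW.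
  have a1' : 0 <= 1 - a by rewrite subr_ge0 ltW.
  have b1' : 0 <= 1 - b by rewrite subr_ge0 ltW.
  have kap0 : 0 <= kap by apply: le_trans k1.
  have sb_le1 : 1 - s * b <= 1 by rewrite lerBlDr lerDl mulr_ge0 // ltW.
  case: y => /=.
    rewrite expr1 ler_pdivrMr ?subr_gt0 //.
    have -> : u * b / (u * a) * (C0 * kap) * (1 - s * a) =
      (C0 * b / a) * (kap * (1 - s * a)) by field; rewrite !lt0r_neq0.
    have ab1 : 1 <= C0 * b / a by rewrite ler_pdivlMr ?mul1r.
    have kab1 : 1 <= kap * (1 - s * a).
      apply: le_trans kab _; rewrite ler_wpM2l //; apply: le_trans sa.
      by rewrite ler_piMr // lerBlDr lerDl ltW.
    exact: le_trans sb_le1 (mulr_ege1 ab1 kab1).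
  rewrite expr0 mul1r ler_pdivrMr ?subr_gt0 //.
  have -> : (1 - u * b) / (1 - u * a) * kap * (1 - s * a) =
     kap * ((1 - s * a) * (1 - u * b)) * (1 - u * a)^-1 by ring.
  apply: le_trans sb_le1 (mulr_ege1 _ _).
    by apply: le_trans kab _; rewrite ler_wpM2l // ler_pM.
  rewrite invf_ge1 ?subr_gt0 // lerBlDr lerDl.
  by rewrite mulr_ge0 // ltW.
case=> -[-> ->]; apply: main => //.
by rewrite [(1 - q) * _]mulrC.
Qed.

(** The scores of two labelings differ by a product over the pairs cut by the set
[S] where the labels differ; [S] and its complement cut the same pairs, so [S]
may be taken to contain at most half of the vertices. Scoring a cut pair from
[G1] instead of the union matters only between a matched vertex of [S] and an
unmatched one outside [S]. A matched vertex of [S] lies on at most [N] such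
pairs, of which at most [c] carry an edge since no vertex is crowded. *)
Lemma score_max_misled K c N M X Y Y' sigma tau :
  ~: M \subset light K X Y -> (#|light K X Y| <= N)%N -> ~ crowded c K X Y ->
  (forall e, val e \subset M -> (e \in Y') = (e \in Y)) ->
  score p q s M X Y' sigma <= score p q s M X Y' tau ->
  ~ misled p q s K (C0 ^+ c * kap ^+ N) sigma X Y ->
  (forall i, tau i = sigma i) \/ (forall i, tau i = ~~ sigma i).
Proof.
set L := light K X Y => ML LN ncr YY' le_score nmis.
have k1 := kap_ge1; have c1 := C0_ge1.
pose S0 := [set i | tau i != sigma i].
have [S00|S00] := eqVneq S0 set0.
  by left => i; apply/eqP/negPn; have := in_set0 i; rewrite -S00 inE => ->.
have [S0T|S0T] := eqVneq S0 setT.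
  right => i; have := in_setT i; rewrite -S0T inE.
  by case: (tau i); case: (sigma i).
exfalso; apply: nmis.
have [S [flip Sn0 Sn2]] : exists S, [/\ forall e,
    same_label tau e = same_label sigma e (+) crosses e S,
    (0 < #|S|)%N & (#|S|.*2 <= n)%N].
  have flip e := same_label_flip e (erefl S0).
  have cS := cardsC S0; rewrite card_ord in cS.
  case: (leqP #|S0|.*2 n) => S02.
    by exists S0; split => //; rewrite card_gt0.
  have half (a b m : nat) : (a + b = m -> m < a.*2 -> b.*2 <= m)%N by clear; lia.
  exists (~: S0); split; [by move=> e; rewrite crossesC | | exact: half cS S02].
  by rewrite card_gt0; apply: contra_neq S0T => h; rewrite -[S0]setCK h setC0.
pose B := S :\: M; exists S, B.
have BS : B \subset S by apply/fintype.subsetP => i; rewrite inE => /andP[].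
have SB : S :\: B = S :&: M.
  by apply/setP => i; rewrite !inE; case: (i \in S); case: (i \in M).
have BL v : v \in B -> v \in L.
  by rewrite inE => /andP[vM _]; apply: (fintype.subsetP ML); rewrite inE.
split => //.
  by apply: card_common_touches; apply/fintype.subsetP => v; exact: BL.
pose E2 := [set e | [&& crosses e S, ~~ touches e B & ~~ (val e \subset M)]].
(* An edge of E2 joins a matched vertex of S to an unmatched one outside S. *)
have E2P e : e \in E2 -> exists a w, [/\ a \in val e, w \in val e,
    a \in S :&: M, w \in L :\: S & w \in L :\ a].
  rewrite inE => /and3P[/andP[/touchesP[a ae aS] /touchesP[w we]]].
  rewrite inE => wS nB nM.
  have aM : a \in M.
    by apply: contraNT nB => aM; apply/touchesP; exists a; rewrite // inE aM.
  have wL : w \in L.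
    have /subsetPn[v ve vM] := nM.
    have vS : v \notin S.
      by apply: contra nB => vS; apply/touchesP; exists v; rewrite // inE vM.
    have [i [j [_ eE]]] := vpairE e; move: ae we ve; rewrite eE !in_set2 => ae we ve.
    have vL : v \in L by apply: (fintype.subsetP ML); rewrite inE.
    suff -> : w = v by [].
    have av : a != v by apply: contraNneq vS => <-.
    have aw : a != w by apply: contraNneq wS => <-.
    by move: ae we ve av aw => /orP[]/eqP-> /orP[]/eqP-> /orP[]/eqP->; rewrite ?eqxx.
  exists a, w; rewrite in_setI in_setD in_setD1 aS aM wS wL; split=> //.
  by rewrite andbT; apply: contraNneq wS => ->.
have cE2 : (#|E2| <= N * #|S :\: B|)%N.
  rewrite SB mulnC; apply: (@leq_trans (#|S :&: M| * #|L :\: S|)%N); last first.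
    by rewrite leq_mul2l (leq_trans _ LN) ?orbT // subset_leq_card // subsetDl.
  rewrite -card_touches2; last by move=> i; rewrite !inE => /andP[->].
  apply/subset_leq_card/fintype.subsetP => e /E2P[a [w [ae we aA wL _]]].
  by rewrite inE; apply/andP; split; apply/touchesP; [exists a|exists w].
have cE2' : (#|[set e in E2 | (e \in X) || (e \in Y)]| <= c * #|S :\: B|)%N.
  apply: leq_trans (@card_exists_le _ _ (S :\: B)
    (fun v e => e \in light_nbrs K X Y v) c _).
    apply/subset_leq_card/fintype.subsetP => e; rewrite SB inE.
    case/andP => /E2P[a [w [ae we aA _ wL]]] eXY; rewrite inE.
    apply/exists_inP; exists a => //; rewrite !inE eXY ae /=.
    by apply/touchesP; exists w.
  move=> v _; rewrite leqNgt; apply/negP => h; apply: ncr; exists v.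
  apply: ltnW; apply: leq_trans h _.
  by apply/subset_leq_card/fintype.subsetP => e; rewrite inE.
have -> : (C0 ^+ c * kap ^+ N) ^+ #|S :\: B| =
    C0 ^+ (c * #|S :\: B|) * kap ^+ (N * #|S :\: B|) by rewrite exprMn -!exprM.
rewrite (score_flip _ _ _ flip) ler_pMr ?score_gt0 // in le_score.
apply: le_trans le_score _.
apply: (@le_trans _ _ (\prod_(e | crosses e S) (
    cut_ratio p q s B sigma e (e \in X) (e \in Y) *
    (if e \in E2 then C0 ^+ ((e \in X) || (e \in Y)) * kap else 1)))).
  apply: ler_prod => e eS; apply/andP; split.
    case: ifP => _; apply: ltW; apply: lik_ratio_gt0 => //.
      exact: union_rate_gt0.
    exact: union_rate_le1.
  rewrite /cut_ratio inE eS /=; case: (boolP (val e \subset M)) => [eM|eM] /=.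
    rewrite YY' // andbF mulr1 ifN //; apply/negP => /touchesP[i ie].
    by rewrite inE (fintype.subsetP eM).
  case: ifP => _ /=; first by rewrite mulr1.
  exact: lik_ratio_le_union.
rewrite big_split /= mulrC ler_wpM2r //.
  by apply: prodr_ge0 => e _; apply/ltW/cut_ratio_gt0.
rewrite -big_mkcondr /= (eq_bigl (fun e => e \in E2)); last first.
  by move=> e; rewrite inE; case: crosses.
rewrite big_split /= prodr_const; apply: ler_pM.
- by apply: prodr_ge0 => e _; rewrite exprn_ge0 // (le_trans ler01).
- by rewrite exprn_ge0 // (le_trans ler01).
- rewrite prodrXr; apply: ler_weXn2l => //; apply: leq_trans cE2'.
  rewrite -sum1_card [leqRHS]big_mkcond [leqLHS]big_mkcond /=.
  by apply: leq_sum => e _; rewrite [in leqRHS]in_set; case: (e \in E2); case: orb.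
- exact: ler_weXn2l.
Qed.

End Ratios.
End Likelihood.

(** * Light vertices are rare and scattered *)

Lemma prod_le_two (R : realType) (I : finType) (m : I -> R) (F G : {set I}) (a b : R) :
  (forall i, 0 <= m i) -> {in F, forall i, m i <= a} -> {in G, forall i, m i <= b} ->
  {in F, forall i, i \notin G} -> (forall i, i \notin F -> i \notin G -> m i <= 1) ->
  \prod_i m i <= a ^+ #|F| * b ^+ #|G|.
Proof.
move=> m0 mF mG FG m1.
rewrite -!prodr_const [X in _ <= X * _]big_mkcond [X in _ <= _ * X]big_mkcond.
rewrite -big_split /=.
apply: ler_prod => i _; rewrite m0 /=.
case: (boolP (i \in F)) => iF; first by rewrite (negPf (FG i iF)) mulr1 mF.
case: (boolP (i \in G)) => iG; first by rewrite mul1r mG.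
by rewrite mul1r m1.
Qed.

Section LightProb.
Variables (R : realType) (n : nat) (p q s : R).
Hypotheses (p01 : 0 <= p <= 1) (q01 : 0 <= q <= 1) (s01 : 0 <= s <= 1).
Implicit Types (sigma : labels n) (T U : {set 'I_n}) (F : {set vpair n}).

Let pmax := Num.max p q.
Let pmin := Num.min p q.

Lemma edge_prob_le_max sigma e : edge_prob p q sigma e <= pmax.
Proof. by rewrite /edge_prob /pmax le_max; case: ifP => _; rewrite lexx ?orbT. Qed.

Lemma edge_prob_ge_min sigma e : pmin <= edge_prob p q sigma e.
Proof. by rewrite /edge_prob /pmin ge_min; case: ifP => _; rewrite lexx ?orbT. Qed.

Lemma visible_moment (r : R) : 0 <= r <= 1 ->
  \sum_(b1 : bool) \sum_(b2 : bool) pair_weight r s b1 b2 * (b1 || b2)%:R <= r.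
Proof.
move=> /andP[r0 r1]; rewrite !big_bool /pair_weight /bernoulli_weight /=.
rewrite !mulr0 !mulr1 !addr0.
have -> : r * (s * s) + r * (s * (1 - s)) + r * ((1 - s) * s) =
   r * (1 - (1 - s) ^+ 2) by ring.
by rewrite ler_piMr // lerBlDr lerDl sqr_ge0.
Qed.

Lemma common_moment (r theta : R) :
  \sum_(b1 : bool) \sum_(b2 : bool) pair_weight r s b1 b2 * theta ^+ (b1 && b2) =
  1 - (1 - theta) * s ^+ 2 * r.
Proof.
by rewrite !big_bool /pair_weight /bernoulli_weight /= expr0 expr1; ring.
Qed.

Lemma expR_ge_sub1 (x : R) : 1 - x <= expR (- x).
Proof. exact: expR_ge1Dx. Qed.

(** The factor [1 / 2] per common edge between [T] and [U] tilts the law towards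
few such edges; a light set has at most [K * #|T|] of them. The pairs of [F] are
different ones, so the two costs multiply. *)
Lemma light_set_prob sigma K T U F :
  {in T, forall i, i \notin U} ->
  {in F, forall e, ~~ (touches e T && touches e U)} ->
  cond_prob p q s sigma (fun X Y => T \subset light K X Y /\ F \subset X :|: Y) <=
  2 ^+ (K * #|T|) * (pmax ^+ #|F| * expR (- (s ^+ 2 * pmin / 2)) ^+ (#|T| * #|U|)).
Proof.
move=> TU FTU; pose C := [set e | touches e T && touches e U].
pose phi (e : vpair n) (b1 b2 : bool) : R :=
  if e \in F then (b1 || b2)%:R else if e \in C then 2^-1 ^+ (b1 && b2) else 1.
have h0 : (0 : R) <= 2^-1 by rewrite invr_ge0.
have phi0 e b1 b2 : 0 <= phi e b1 b2.
  by rewrite /phi; case: ifP => _ //; case: ifP => // _; exact: exprn_ge0.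
apply: le_trans (cond_prob_markov p01 q01 s01 sigma phi0
  (exprn_ge0 (K * #|T|) (ler0n _ 2)) _) _.
  move=> X Y [TL FXY].
  have -> : \prod_e phi e (e \in X) (e \in Y) =
      2^-1 ^+ #|[set e in X :&: Y | touches e T && touches e U]|.
    rewrite -prodr_const [RHS]big_mkcond; apply: eq_bigr => e _.
    rewrite /phi !inE; case: (boolP (e \in F)) => [eF|eF].
      have := fintype.subsetP FXY e eF; rewrite inE => ->.
      by rewrite (negPf (FTU e eF)) andbF.
    by case: (touches e T && touches e U); case: (e \in X); case: (e \in Y).
  have := @card_common_touches n K X Y T (fun e => touches e U) TL.
  move/(ler_weXn2l (ler1n R 2)); rewrite exprVn ler_pdivlMr ?exprn_gt0 //.
  by rewrite mul1r.
rewrite ler_wpM2l ?exprn_ge0 // -card_touches2 // -/C.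
have m0 e : 0 <= \sum_(b1 : bool) \sum_(b2 : bool)
    pair_weight (edge_prob p q sigma e) s b1 b2 * phi e b1 b2.
  apply: sumr_ge0 => b1 _; apply: sumr_ge0 => b2 _.
  by rewrite mulr_ge0 ?pair_weight_ge0 ?edge_prob01.
apply: prod_le_two => // e; rewrite /phi.
- move=> ->; apply: le_trans (edge_prob_le_max sigma e).
  exact/visible_moment/edge_prob01.
- move=> eC; have /negPf eF : e \notin F by apply: contraL eC => /FTU; rewrite inE.
  rewrite eF eC common_moment.
  have -> : 1 - 2^-1 = 2^-1 :> R by field.
  apply: le_trans (expR_ge_sub1 _) _; rewrite ler_expR lerN2.
  by have := ler_wpM2l (sqr_ge0 s) (edge_prob_ge_min sigma e); lra.
- by move/FTU; rewrite inE.
move=> /negPf -> /negPf ->.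
under eq_bigr do under eq_bigr do rewrite mulr1.
by rewrite sum_pair_weight.
Qed.

Lemma exists_subset_card (A : {set 'I_n}) c : (c <= #|A|)%N ->
  exists2 T : {set 'I_n}, T \subset A & #|T| = c.
Proof.
move=> cA; exists [set i in take c (enum A)].
  by apply/fintype.subsetP => i; rewrite inE => /mem_take; rewrite mem_enum.
rewrite cardsE (card_uniqP _) ?take_uniq ?enum_uniq // size_take -cardE.
by case: ltngtP cA.
Qed.

(** The [c] light neighbours of a vertex are nearly independently light: their
pairs with the other vertices are all distinct. *)
Lemma crowded_prob sigma c K : (c < n)%N ->
  cond_prob p q s sigma (crowded c K) <=
  n%:R * n%:R ^+ c * (2 ^+ (K * c) * (pmax ^+ c *
     expR (- (s ^+ 2 * pmin / 2)) ^+ (c * (n - c.+1)))).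
Proof.
move=> cn; pose F (x : 'I_n * {set 'I_n}) := 
  [set e : vpair n | touches e [set x.1] && touches e x.2].
apply: le_trans (@cond_prob_union R n p q s p01 q01 s01 _
  (fun x : 'I_n * {set 'I_n} => (#|x.2| == c) && (x.1 \notin x.2)) _ _
  (fun x X Y => x.2 \subset light K X Y /\ F x \subset X :|: Y) _) _.
  move=> X Y [v cv]; set L := light K X Y in cv *.
  pose T0 := [set w in L :\ v | [exists e in X :|: Y, val e == [set v; w]]].
  have cT0 : (c <= #|T0|)%N.
    apply: leq_trans cv _; rewrite -(card_imset _ val_inj).
    apply: leq_trans (leq_imset_card (fun w => [set v; w]) _).
    apply/subset_leq_card/fintype.subsetP => Z /imsetP[e + ->].
    rewrite inE => /and3P[eXY ve /touchesP[w we wL]]; apply/imsetP.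
    have eE : val e = [set v; w].
      apply/esym/eqP; rewrite eqEcard (eqP (valP e)) cards2.
      have -> : v != w by move: wL; rewrite !inE eq_sym => /andP[].
      by rewrite andbT; apply/fintype.subsetP => i; rewrite !inE => /orP[]/eqP->.
    by exists w => //; rewrite inE wL; apply/exists_inP; exists e => //; rewrite eE.
  have [T TT0 cT] := exists_subset_card cT0; exists (v, T) => /=.
    rewrite cT eqxx; apply/negP => /(fintype.subsetP TT0).
    by rewrite !inE eqxx.
  split; apply/fintype.subsetP.
    by move=> w /(fintype.subsetP TT0); rewrite !inE => /andP[/andP[]].
  move=> e; rewrite inE => /andP[/touchesP[v']] ve; rewrite inE => /eqP/= vv.
  case/touchesP => w we wT; have := fintype.subsetP TT0 w wT.
  rewrite inE => /andP[wL /exists_inP[e' e'XY /eqP e'E]].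
  suff -> : e = e' by [].
  apply: val_inj; rewrite [val e']e'E; apply/esym/eqP.
  rewrite eqEcard (eqP (valP e)) cards2 -vv.
  have -> : v' != w by move: wL; rewrite !inE eq_sym vv => /andP[].
  by rewrite andbT; apply/fintype.subsetP => i; rewrite !inE => /orP[]/eqP->.
set b := 2 ^+ _ * _.
apply: (@le_trans _ _ (\sum_(x : 'I_n * {set 'I_n} | (#|x.2| == c) && (x.1 \notin x.2)) b)).
  apply: ler_sum => -[v T] /= /andP[/eqP cT vT].
  apply: le_trans (@light_set_prob sigma K T (~: (v |: T)) (F (v, T)) _ _) _.
  - by move=> i iT; rewrite !inE iT orbT.
  - move=> e; rewrite inE /=; have [i [j [ij eE]]] := vpairE e.
    rewrite !(touches_pair _ eE) !inE; apply: contraL => /andP[].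
    have := vT; have := ij; rewrite ![_ == v]eq_sym.
    case: (eqVneq v i) => [<-|_]; case: (eqVneq v j) => [<-|_] //=.
    + by move=> _ /negPf->; case: (j \in T).
    + by move=> _ /negPf->; case: (i \in T).
  rewrite /b cT card_touches2; last first.
    by move=> i; rewrite inE => /eqP ->.
  rewrite cards1 mul1n cT.
  suff -> : #|~: (v |: T)| = (n - c.+1)%N by [].
  by have := cardsC (v |: T); rewrite cardsU1 vT cT card_ord; lia.
rewrite sumr_const -[leLHS]mulr_natl ler_wpM2r //.
  by rewrite /b !mulr_ge0 ?exprn_ge0 ?expR_ge0 // /pmax le_max; case/andP: p01 => ->.
rewrite -natrX -natrM ler_nat.
apply: (@leq_trans #|setX [set: 'I_n] [set T : {set 'I_n} | #|T| == c]|).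
  by apply/subset_leq_card/fintype.subsetP => -[v T]; rewrite !inE /= => /andP[].
rewrite cardsX cardsT card_ord leq_mul2l card_draws card_ord.
apply/orP; right; apply: (@leq_trans (n ^_ c)).
  by rewrite -bin_ffact leq_pmulr // fact_gt0.
elim: (c) => [|d IH]; first by rewrite ffactn0.
by rewrite ffactnSr expnSr leq_mul // leq_subr.
Qed.

(** A vertex is light with vanishing probability, so Markov's inequality bounds
the number of light vertices. *)
Lemma many_light_prob sigma K N :
  N.+1%:R * cond_prob p q s sigma (fun X Y => (N < #|light K X Y|)%N) <=
  n%:R * (2 ^+ K * expR (- (s ^+ 2 * pmin / 2)) ^+ n.-1).
Proof.
apply: le_trans (@cond_prob_count R n p q s p01 q01 s01 'I_n predT sigma N.+1 _
  (fun v X Y => [set v] \subset light K X Y /\ set0 \subset X :|: Y) _) _.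
  move=> X Y h; apply: leq_trans h _; apply/subset_leq_card/fintype.subsetP => v vL.
  by rewrite inE /=; apply/asboolP; rewrite finset.sub1set vL finset.sub0set.
rewrite -[X in X%:R * _]card_ord mulr_natl -sumr_const; apply: ler_sum => v _.
apply: le_trans (@light_set_prob sigma K [set v] (~: [set v]) set0 _ _) _.
- by move=> i; rewrite !inE => /eqP->; rewrite eqxx.
- by move=> e; rewrite inE.
by rewrite cards0 cards1 mul1r muln1 mul1n cardsC1 card_ord.
Qed.

End LightProb.

(** * No dense set is wrongly matched *)

(** A largest subset of [N] disjoint from its image: each further element of [N]
lies in the image or the preimage of that subset, each no larger than it. *)
Lemma exists_disjoint_image (T : finType) (f : T -> T) (N : {set T}) :
  injective f -> {in N, forall x, f x != x} ->
  exists2 F : {set T}, F \subset N /\ {in F, forall x, f x \notin F} &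
    (#|N| <= 3 * #|F|)%N.
Proof.
move=> f_inj fN.
pose P (F : {set T}) := (F \subset N) && [forall x in F, f x \notin F].
have P0 : P set0.
  by rewrite /P finset.sub0set; apply/forall_inP => x; rewrite inE.
case: (arg_maxnP (fun F : {set T} => #|F|) P0) => F /andP[FN /forall_inP Ff] Fmax.
exists F => //; suff NF : N \subset F :|: (f @: F :|: f @^-1: F).
  apply: leq_trans (subset_leq_card NF) _.
  apply: leq_trans (leq_card_setU _ _) _.
  have := (leq_card_setU (f @: F) (f @^-1: F)).1.
  have := leq_imset_card f F.
  have : (#|f @^-1: F| <= #|F|)%N.
    rewrite -(card_imset _ f_inj); apply/subset_leq_card/fintype.subsetP => y.
    by case/imsetP => x; rewrite inE => ? ->.
  move: #|f @: F :|: _| #|f @^-1: F| #|f @: F| #|F|; clear; lia.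
apply/fintype.subsetP => x xN; rewrite !inE; apply: contraT.
rewrite !negb_or => /and3P[xF xfF fxF].
have : P (x |: F).
  rewrite /P finset.subUset finset.sub1set xN FN /=.
  apply/forall_inP => y; rewrite !inE negb_or => /orP[/eqP->|yF].
    by rewrite fN.
  rewrite Ff // andbT; apply: contraNneq xfF => <-.
  by apply/imsetP; exists y.
by move/Fmax; rewrite cardsU1 xF /= add1n ltnn.
Qed.

Lemma sum_subset_expr (R : realType) (T : finType) (E : {set T}) (y : R) :
  \sum_(F : {set T} | F \subset E) y ^+ #|F| = (1 + y) ^+ #|E|.
Proof.
pose h (e : T) (b : bool) : R := if b then (if e \in E then y else 0) else 1.
transitivity (\sum_(F : {set T}) \prod_e h e (e \in F)).
  rewrite big_mkcond; apply: eq_bigr => F _; rewrite /h.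
  case: ifP => [FE|/negbT/subsetPn[x xF xE]]; last first.
    by rewrite (bigD1 x) //= xF (negPf xE) mul0r.
  rewrite -prodr_const big_mkcond; apply: eq_bigr => e _.
  by case: ifP => // /(fintype.subsetP FE) ->.
rewrite sum_set_prod -prodr_const [RHS]big_mkcond; apply: eq_bigr => e _.
by rewrite /h; case: ifP; rewrite ?add0r // addrC.
Qed.

Section WrongMatch.
Variables (R : realType) (n : nat) (p q s : R).
Hypotheses (p01 : 0 <= p <= 1) (q01 : 0 <= q <= 1) (s01 : 0 <= s <= 1).
Implicit Types (sigma : labels n) (F : {set vpair n}) (X Y : graph n).
Implicit Types (rho : {ffun 'I_n -> 'I_n}).

Let pmax := Num.max p q.

Definition moved rho : {set 'I_n} := [set i | rho i != i].

(** Junk value [e] when [rho] identifies the endpoints of [e]. *)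
Definition pair_image rho (e : vpair n) : vpair n := insubd e (rho @: val e).

(** The trace left by a wrong matching that agrees with [rho] on the dense set:
edges [F] whose images are edges as well, all of them distinct. *)
Definition witness rho F : bool :=
  [&& [exists i, rho i != i], F \subset [set e | touches e (moved rho)],
   (3 * #|moved rho| <= #|F|)%N & #|F :|: pair_image rho @: F| == (2 * #|F|)%N].

Lemma vpair_map_inj (pi : {perm 'I_n}) : injective (@vpair_map n pi).
Proof.
move=> e e' /(congr1 val) /= h; apply: val_inj.
by apply: (imset_inj (@perm_inj _ pi)).
Qed.

Lemma sum_degrees (Z : graph n) (D : {set 'I_n}) :
  (\sum_(v in D) #|[set e in Z | v \in val e]| <= 2 * #|[set e in Z | touches e D]|)%N.
Proof.
rewrite mulnC -sum_nat_const big_mkcond [leqRHS]big_mkcond /=.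
apply: (@leq_trans (\sum_(e : vpair n) \sum_(v in D) ((e \in Z) && (v \in val e)))%N).
  rewrite exchange_big [leqRHS]big_mkcond /=; apply: leq_sum => v _.
  case: ifP => // _; rewrite -sum1_card big_mkcond /=.
  by apply: leq_sum => e _; rewrite inE; case: andb.
apply: leq_sum => e _; rewrite inE; case: (boolP (e \in Z)) => eZ /=; last first.
  by rewrite big1.
case: ifP => [_|/negbT nt].
  apply: (@leq_trans #|val e|); last by rewrite (eqP (valP e)).
  rewrite -sum1_card big_mkcond [leqRHS]big_mkcond /=.
  by apply: leq_sum => v _; case: (v \in D).
rewrite big1 // => v vD; apply/eqP; rewrite eqb0; apply: contra nt => ve.
by apply/touchesP; exists v.
Qed.

(** Let [d] vertices of the dense set be moved. They touch at least [10 * d] edges,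
since each has 20 and an edge has two ends. At most [d] of these edges are
mapped to themselves, and at least a third of the [9 * d] others form a set
disjoint from its image. *)
Lemma wrong_match_witness X Y : wrong_match 20 X Y ->
  exists2 x : {ffun 'I_n -> 'I_n} * {set vpair n}, witness x.1 x.2 &
    x.2 :|: pair_image x.1 @: x.2 \subset X :|: Y.
Proof.
case=> rho0 [M [dM [i0 i0M rho_i0]]]; pose pi := (rho0^-1)%g.
pose D := [set i in M | pi i != i].
have i0D : i0 \in D.
  by rewrite inE i0M /=; apply: contra rho_i0 => /eqP {1}<-; rewrite permKV.
pose N0 := [set e in [set e in X :&: relabel rho0 Y | val e \subset M] | touches e D].
pose N1 := [set e in N0 | vpair_map pi e == e].
have cN0 : (10 * #|D| <= #|N0|)%N.
  have := sum_degrees [set e in X :&: relabel rho0 Y | val e \subset M] D.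
  rewrite -/N0 => h; have : (#|D| * 20 <= 2 * #|N0|)%N.
    apply: leq_trans h; rewrite -sum_nat_const; apply: leq_sum => v.
    rewrite inE => /andP[/(forall_inP dM) vM _]; apply: leq_trans vM _.
    apply/subset_leq_card/fintype.subsetP => e.
    by rewrite !inE => /and3P[-> -> ->].
  by move: #|N0| #|D|; clear; lia.
have cN1 : (#|N1| <= #|D|)%N.
  rewrite -(card_imset _ val_inj).
  apply: leq_trans (leq_imset_card (fun v => [set v; pi v]) D).
  apply/subset_leq_card/fintype.subsetP => Z /imsetP[e + ->].
  rewrite inE => /andP[]; rewrite inE => /andP[_ /touchesP[v ve vD]] /eqP pie.
  apply/imsetP; exists v => //; apply/esym/eqP.
  have pve : pi v \in val e by rewrite -pie; apply: imset_f.
  rewrite eqEcard (eqP (valP e)) cards2.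
  have -> : v != pi v by move: vD; rewrite inE eq_sym => /andP[].
  by rewrite andbT; apply/fintype.subsetP => i; rewrite !inE => /orP[]/eqP->.
have [|F [FN Ff] cF] := @exists_disjoint_image _ (vpair_map pi) (N0 :\: N1)
    (@vpair_map_inj pi).
  by move=> e; rewrite !inE => /andP[+ eN0]; rewrite eN0.
have {}cF : (3 * #|D| <= #|F|)%N.
  have := cardsID N1 N0; have : (#|N0 :&: N1| <= #|N1|)%N.
    by apply: subset_leq_card; apply: subsetIr.
  move: cF cN0 cN1.
  by move: #|N0 :\: N1| #|N0 :&: N1| #|N0| #|N1| #|D| #|F|; clear; lia.
pose rho : {ffun 'I_n -> 'I_n} := [ffun i => if i \in D then pi i else i].
have mD : moved rho = D.
  apply/setP => i; rewrite !inE ffunE inE.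
  by case: (boolP (i \in M)) => _ /=; [case: ifP|]; rewrite ?eqxx.
have F0 e : e \in F -> [/\ e \in X, vpair_map pi e \in Y, val e \subset M & touches e D].
  move/(fintype.subsetP FN); rewrite !inE => /andP[_ /andP[/andP[/andP[-> eY] ->] ->]].
  by rewrite mem_relabel in eY.
have imF e : e \in F -> pair_image rho e = vpair_map pi e.
  move=> /F0[_ _ eM _]; have E : rho @: val e = pi @: val e.
    apply: eq_in_imset => i /(fintype.subsetP eM) iM; rewrite ffunE inE iM /=.
    by case: eqVneq => [->|].
  apply: val_inj; rewrite /pair_image val_insubd E.
  by rewrite (eqP (vpair_map_subproof pi e)) eqxx.
exists (rho, F) => /=.
  apply/and4P; split.
  - by apply/existsP; exists i0; move: i0D; rewrite -mD inE.
  - by apply/fintype.subsetP => e /F0[_ _ _]; rewrite inE mD.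
  - by rewrite mD.
  have disj : F :&: pair_image rho @: F = set0.
    apply/setP => e; rewrite !inE; apply/negP => /andP[eF /imsetP[e' e'F eE]].
    by have := Ff e' e'F; rewrite -imF // -eE eF.
  rewrite cardsU disj cards0 subn0 card_in_imset ?mul2n ?addnn //.
  by move=> e e' eF e'F; rewrite !imF // => /vpair_map_inj.
apply/fintype.subsetP => e; rewrite !inE => /orP[/F0[->]//|/imsetP[e' e'F ->]].
by rewrite imF //; case: (F0 _ e'F) => _ ->; rewrite orbT.
Qed.

Lemma visible_set_prob sigma F :
  cond_prob p q s sigma (fun X Y => F \subset X :|: Y) <= pmax ^+ #|F|.
Proof.
have h1 : {in (set0 : {set 'I_n}), forall i, i \notin (set0 : {set 'I_n})}.
  by move=> i; rewrite inE.
have h2 : {in F, forall e, ~~ (touches e set0 && touches e set0)}.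
  by move=> e _; apply/negP => /andP[/touchesP[i _]]; rewrite inE.
apply: le_trans (le_trans _ (@light_set_prob R n p q s p01 q01 s01 sigma 0 _ _ F h1 h2)) _.
  by apply: cond_prob_sub => // X Y FXY; split=> //; exact: finset.sub0set.
by rewrite cards0 !mul0n !expr0 mulr1 mul1r.
Qed.

(** Union bound over the witnesses. For a fixed [rho] the sum over [F] is a
binomial sum over the pairs that touch a moved vertex, and the sum over all
[rho] factorizes over the vertices. *)
Lemma wrong_match_prob sigma : (0 < n)%N -> 0 < pmax -> n%:R * pmax ^+ 2 <= 1 ->
  cond_prob p q s sigma (wrong_match 20) <=
  (1 + n%:R * (expR 1 * (n%:R * pmax ^+ 2) ^+ 3)) ^+ n - 1.
Proof.
move=> n0 pmax0 np1.
apply: le_trans (@cond_prob_union R n p q s p01 q01 s01 _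
  (fun x => witness x.1 x.2) sigma _
  (fun x X Y => x.2 :|: pair_image x.1 @: x.2 \subset X :|: Y) _) _.
  exact: wrong_match_witness.
set x := expR 1 * _.
have nR : 0 < n%:R :> R by rewrite ltr0n.
have np0 : 0 <= n%:R * pmax ^+ 2 by rewrite mulr_ge0 // sqr_ge0.
have x0 : 0 <= x by rewrite mulr_ge0 ?expR_ge0 // exprn_ge0.
(* The weight z ^+ (#|F| - 3 * #|moved rho|) >= 1 relaxes the constraint on #|F|;
   this z makes the base of the binomial sum 1 + 1 / n. *)
pose z : R := (n%:R * pmax ^+ 2)^-1.
have z0 : 0 < z by rewrite invr_gt0 mulr_gt0 // exprn_gt0.
have z1 : 1 <= z by rewrite invf_ge1 // mulr_gt0 // exprn_gt0.
have zp : z * pmax ^+ 2 = n%:R^-1.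
  by rewrite /z invfM -mulrA mulVf ?mulr1 // lt0r_neq0 // exprn_gt0.
have per_rho (rho : {ffun 'I_n -> 'I_n}) : 
    \sum_(F : {set vpair n} | witness rho F) pmax ^+ (2 * #|F|) <= x ^+ #|moved rho|.
  set d := #|moved rho|; set E := [set e | touches e (moved rho)].
  apply: (@le_trans _ _ (\sum_(F : {set vpair n} | F \subset E)
     (z^-1 ^+ (3 * d) * (z * pmax ^+ 2) ^+ #|F|))).
    rewrite big_mkcond [leRHS]big_mkcond /=; apply: ler_sum => F _.
    case: ifP => [/and4P[_ -> dF _]|_]; last first.
      by case: ifP => // _; rewrite !mulr_ge0 ?exprn_ge0 ?mulr_ge0 ?exprn_ge0 ?invr_ge0 // ltW.
    have g0 : 0 <= (pmax ^+ 2) ^+ #|F| by rewrite exprn_ge0 // sqr_ge0.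
    rewrite exprMn mulrA [pmax ^+ (2 * _)]exprM; apply: (ler_peMl g0).
    rewrite exprVn mulrC ler_pdivlMr ?exprn_gt0 // mul1r.
    exact: ler_weXn2l.
  rewrite -mulr_sumr sum_subset_expr zp invrK.
  rewrite [leLHS]mulrC [x ^+ d]exprMn -[_ ^+ 3 ^+ d]exprM ler_pM //.
    by rewrite exprn_ge0 // addr_ge0 // invr_ge0 ltW.
  have n1 : 1 <= 1 + n%:R^-1 :> R by rewrite lerDl invr_ge0 ltW.
  apply: le_trans (ler_weXn2l n1 (card_touches_le (moved rho))) _.
  rewrite -/d mulnC exprM; apply: lerXn2r;
    rewrite ?nnegrE ?expR_ge0 ?exprn_ge0 ?(le_trans ler01) //.
  have : 1 + n%:R^-1 <= expR (n%:R^-1) :> R by exact: expR_ge1Dx.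
  move/(lerXn2r n); rewrite !nnegrE (le_trans ler01 n1) expR_ge0 => /(_ isT isT).
  by rewrite -expRM_natl divff // lt0r_neq0.
apply: (@le_trans _ _ (\sum_(rho : {ffun 'I_n -> 'I_n} | [exists i, rho i != i])
   x ^+ #|moved rho|)).
  apply: (@le_trans _ _ (\sum_(rho : {ffun 'I_n -> 'I_n} | [exists i, rho i != i])
    \sum_(F : {set vpair n} | witness rho F) pmax ^+ (2 * #|F|))); last first.
    by apply: ler_sum => rho _; exact: per_rho.
  rewrite [leRHS]pair_big_dep /= [leLHS]big_mkcond [leRHS]big_mkcond /=.
  apply: ler_sum => -[rho F] _ /=.
  case: ifP => [wF|_]; last by case: ifP => // _; rewrite exprn_ge0 // ltW.
  case/and4P: (wF) => -> _ _ /eqP <- /=; exact: visible_set_prob.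
pose one : {ffun 'I_n -> 'I_n} := [ffun i => i].
have xE rho : x ^+ #|moved rho| = \prod_i (if rho i == i then 1 else x).
  rewrite -prodr_const big_mkcond; apply: eq_bigr => i _; rewrite inE.
  by case: eqP.
have -> : (1 + n%:R * x) ^+ n =
    \prod_(i < n) (1 + n%:R * x) by rewrite prodr_const card_ord.
rewrite lerBrDr.
apply: (@le_trans _ _ (\sum_(rho : {ffun 'I_n -> 'I_n}) x ^+ #|moved rho|)).
  rewrite [leRHS](bigID (fun rho : {ffun 'I_n -> 'I_n} => [exists i, rho i != i])) /= lerD2l.
  rewrite (bigD1 one) /=; last first.
    by apply/existsPn => i; rewrite ffunE eqxx.
  rewrite [X in x ^+ X]eq_card0 ?expr0; last by move=> i; rewrite !inE ffunE eqxx.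
  by rewrite lerDl; apply: sumr_ge0 => *; exact: exprn_ge0.
under eq_bigr do rewrite xE.
rewrite -(bigA_distr_bigA (fun i j : 'I_n => if j == i then 1 else x)) /=.
apply: ler_prod => i _; rewrite sumr_ge0 /=; last by move=> j _; case: ifP.
rewrite (bigD1 i) //= eqxx lerD2l.
apply: (@le_trans _ _ (\sum_(j < n) x)); last by rewrite sumr_const card_ord mulr_natl.
rewrite big_mkcond; apply: ler_sum => j _; case: ifP => // /negPf ->; exact: lexx.
Qed.

End WrongMatch.

(** * The data are rarely misleading *)

Section Misled.
Variables (R : realType) (n : nat) (p q s : R).
Hypotheses (p0 : 0 < p) (p1 : p < 1) (q0 : 0 < q) (q1 : q < 1).
Hypotheses (s0 : 0 < s) (s1 : s <= 1).
Implicit Types (sigma : labels n) (S B : {set 'I_n}) (X Y : graph n).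

Let u := union_rate s.

Lemma mul_sqrt_div (x y : R) : 0 < x -> x * Num.sqrt (y / x) = Num.sqrt (x * y).
Proof.
move=> x0; rewrite -{1}[x]ger0_norm ?ltW // -sqrtr_sqr -sqrtrM ?sqr_ge0 //.
by congr Num.sqrt; field; rewrite lt0r_neq0.
Qed.

Lemma sqrt_mul_le_mean (x y : R) : 0 <= x -> 0 <= y -> Num.sqrt (x * y) <= (x + y) / 2.
Proof.
move=> x0 y0; have h : 0 <= (x + y) / 2 by rewrite divr_ge0 ?addr_ge0.
rewrite -[leRHS]ger0_norm // -sqrtr_sqr; apply: ler_wsqrtr.
rewrite -subr_ge0; have -> : ((x + y) / 2) ^+ 2 - x * y = ((x - y) / 2) ^+ 2 by field.
exact: sqr_ge0.
Qed.

Lemma edge_prob_swap sigma e :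
  edge_prob p q sigma e * edge_prob q p sigma e = p * q /\
  edge_prob p q sigma e + edge_prob q p sigma e = p + q.
Proof. by rewrite /edge_prob; case: ifP => _; split=> //; rewrite (mulrC, addrC). Qed.

(** A Bhattacharyya coefficient: the mean of the square root of the likelihood
ratio, split according to the presence of the edge. *)
Lemma half_ratio_true (t : R) sigma e : 0 < t -> t <= 1 ->
  t * edge_prob p q sigma e * Num.sqrt (lik_ratio p q t sigma e true) =
  t * Num.sqrt (p * q).
Proof.
move=> t0 t1; have [h h'] := edge_lik_gt0 p0 p1 q0 q1 sigma e true t0 t1.
rewrite /lik_ratio -[t * edge_prob p q sigma e]/(edge_lik p q t sigma e true).
rewrite mul_sqrt_div // /edge_lik /= mulrACA (edge_prob_swap sigma e).1.
by rewrite sqrtrM ?mulr_ge0 ?ltW // -expr2 sqrtr_sqr ger0_norm // ltW.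
Qed.

Lemma half_ratio_false (t : R) sigma e : 0 < t -> t <= 1 ->
  (1 - t * edge_prob p q sigma e) * Num.sqrt (lik_ratio p q t sigma e false) <=
  1 - t * (p + q) / 2.
Proof.
move=> t0 t1; have [h h'] := edge_lik_gt0 p0 p1 q0 q1 sigma e false t0 t1.
rewrite /lik_ratio -[1 - t * edge_prob p q sigma e]/(edge_lik p q t sigma e false).
rewrite mul_sqrt_div //; apply: le_trans (sqrt_mul_le_mean (ltW h) (ltW h')) _.
rewrite /edge_lik /= -(edge_prob_swap sigma e).2.
lra.
Qed.

Definition union_exponent : R := u * ((p + q) / 2 - Num.sqrt (p * q)).

Definition light_exponent (theta : R) : R :=
  s * (p + q) / 2 - (s * (1 - s) + theta * s ^+ 2) * Num.sqrt (p * q).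

Lemma union_half_moment sigma e :
  \sum_(b1 : bool) \sum_(b2 : bool) pair_weight (edge_prob p q sigma e) s b1 b2 *
     Num.sqrt (lik_ratio p q u sigma e (b1 || b2)) <= expR (- union_exponent).
Proof.
have u0 := union_rate_gt0 s0 s1; have u1 := union_rate_le1 s.
have := half_ratio_true sigma e u0 u1; have := half_ratio_false sigma e u0 u1.
rewrite -/u !big_bool /pair_weight /bernoulli_weight /=.
move: (Num.sqrt (lik_ratio _ _ _ _ _ true)) (Num.sqrt (lik_ratio _ _ _ _ _ false)).
move: (edge_prob p q sigma e) => r a b hb ha.
apply: le_trans (expR_ge_sub1 _); rewrite /union_exponent.
have -> : 1 - u * ((p + q) / 2 - Num.sqrt (p * q)) = 1 - u * (p + q) / 2 + u * r * a.
  by rewrite ha; ring.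
by move: hb; rewrite /u /union_rate; lra.
Qed.

Lemma light_half_moment (theta : R) sigma e :
  \sum_(b1 : bool) \sum_(b2 : bool) pair_weight (edge_prob p q sigma e) s b1 b2 *
     (Num.sqrt (lik_ratio p q s sigma e b1) * theta ^+ (b1 && b2)) <=
  expR (- light_exponent theta).
Proof.
have := half_ratio_true sigma e s0 s1; have := half_ratio_false sigma e s0 s1.
rewrite !big_bool /pair_weight /bernoulli_weight /= !expr0 expr1.
move: (Num.sqrt (lik_ratio _ _ _ _ _ true)) (Num.sqrt (lik_ratio _ _ _ _ _ false)).
move: (edge_prob p q sigma e) => r a b hb ha.
apply: le_trans (expR_ge_sub1 _); rewrite /light_exponent.
have -> : (s * (1 - s) + theta * s ^+ 2) * Num.sqrt (p * q) =
   (1 - s + theta * s) * (s * Num.sqrt (p * q)) by ring.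
by rewrite -ha; move: hb; lra.
Qed.

Lemma one_le_mul_sqrt (c x : R) : 1 <= c -> 0 <= x -> 1 <= c * x ->
  1 <= c * Num.sqrt x.
Proof.
move=> c1 x0 cx; have c0 : 0 <= c by apply: le_trans c1.
have [x1|/ltW x1] := leP 1 x.
  by rewrite mulr_ege1 // -[leLHS]sqrtr1 ler_wsqrtr.
apply: le_trans cx _; rewrite ler_wpM2l // -[leLHS]ger0_norm // -sqrtr_sqr.
by rewrite ler_wsqrtr // expr2 ler_piMl.
Qed.

Lemma sqrt_prod (I : finType) (P : pred I) (F : I -> R) : (forall i, 0 <= F i) ->
  Num.sqrt (\prod_(i | P i) F i) = \prod_(i | P i) Num.sqrt (F i).
Proof.
move=> F0; suff [] : 0 <= \prod_(i | P i) F i /\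
    Num.sqrt (\prod_(i | P i) F i) = \prod_(i | P i) Num.sqrt (F i) by [].
elim/big_ind2: _ => [|x y z t [x0 xy] [z0 zt]|i _]; first by rewrite sqrtr1.
  by rewrite mulr_ge0 // sqrtrM // xy zt.
by [].
Qed.

Let p01 : 0 <= p <= 1. Proof. by rewrite !ltW. Qed.
Let q01 : 0 <= q <= 1. Proof. by rewrite !ltW. Qed.
Let s01 : 0 <= s <= 1. Proof. by rewrite s1 ltW. Qed.

(** The cost of one flipped set [S] whose part [B] is unmatched; the factor
[theta] tilts the law towards few common edges at [B]. *)
Lemma misled_set_prob (K : nat) (Lam theta : R) sigma S B :
  0 < theta -> theta <= 1 -> 1 <= Lam -> B \subset S ->
  cond_prob p q s sigma (fun X Y =>
    (#|[set e in X :&: Y | touches e B && crosses e S]| <= K * #|B|)%N /\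
    1 <= Lam ^+ #|S :\: B| *
       \prod_(e | crosses e S) cut_ratio p q s B sigma e (e \in X) (e \in Y)) <=
  Lam ^+ #|S :\: B| * theta^-1 ^+ (K * #|B|) *
  (expR (- light_exponent theta) ^+ (#|B| * #|~: S|) *
   expR (- union_exponent) ^+ (#|S :\: B| * #|~: S|)).
Proof.
move=> t0 t1 Lam1 BS.
pose phi (e : vpair n) (b1 b2 : bool) : R :=
  if crosses e S then Num.sqrt (cut_ratio p q s B sigma e b1 b2) *
    (if touches e B then theta ^+ (b1 && b2) else 1) else 1.
have phi0 e b1 b2 : 0 <= phi e b1 b2.
  rewrite /phi; case: ifP => // _; rewrite mulr_ge0 ?sqrtr_ge0 //.
  by case: ifP => // _; rewrite exprn_ge0 // ltW.
have L1 : 1 <= Lam ^+ #|S :\: B| by exact: exprn_ege1.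
have c0 : 0 <= Lam ^+ #|S :\: B| * theta^-1 ^+ (K * #|B|).
  by rewrite mulr_ge0 ?(le_trans ler01 L1) // exprn_ge0 // invr_ge0 ltW.
apply: le_trans (cond_prob_markov p01 q01 s01 sigma phi0 c0 _) _.
  move=> X Y [cnt ge1].
  have -> : \prod_e phi e (e \in X) (e \in Y) =
     Num.sqrt (\prod_(e | crosses e S) cut_ratio p q s B sigma e (e \in X) (e \in Y)) *
     theta ^+ #|[set e in X :&: Y | touches e B && crosses e S]|.
    rewrite sqrt_prod; last by move=> e; apply/ltW/cut_ratio_gt0.
    rewrite -[X in _ = _ * X]prodr_const [X in _ = X * _]big_mkcond [X in _ = _ * X]big_mkcond.
    rewrite -big_split; apply: eq_bigr => e _ /=; rewrite /phi !inE.
    case: (crosses e S); last by rewrite !andbF mulr1.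
    by case: (touches e B); rewrite ?andbF ?andbT //; case: (e \in X); case: (e \in Y).
  set m := #|[set e in X :&: Y | _]| in cnt *.
  have r0 : 0 <= \prod_(e | crosses e S) cut_ratio p q s B sigma e (e \in X) (e \in Y).
    by apply: prodr_ge0 => e _; apply/ltW/cut_ratio_gt0.
  have h := one_le_mul_sqrt L1 r0 ge1.
  rewrite mulrACA; apply: mulr_ege1; first exact: h.
  rewrite exprVn mulrC ler_pdivlMr ?exprn_gt0 // mul1r.
  by apply: ler_wiXn2l => //; exact: ltW.
rewrite ler_wpM2l //.
have outB : {in B, forall i, i \notin ~: S}.
  by move=> i /(fintype.subsetP BS) iS; rewrite inE iS.
have outA : {in S :\: B, forall i, i \notin ~: S}.
  by move=> i; rewrite !inE => /andP[_ ->].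
rewrite -!card_touches2 //.
have cutE e : crosses e S =
    (touches e B && touches e (~: S)) || (touches e (S :\: B) && touches e (~: S)).
  rewrite -andb_orl /crosses; congr (_ && _); have [i [j [_ eE]]] := vpairE e.
  rewrite !(touches_pair _ eE) !inE.
  case: (boolP (i \in B)) => [/(fintype.subsetP BS)->|_];
    case: (boolP (j \in B)) => [/(fintype.subsetP BS)->|_];
    by case: (i \in S); case: (j \in S).
have cut_touch e : touches e (S :\: B) && touches e (~: S) -> ~~ touches e B.
  have [i [j [_ eE]]] := vpairE e.
  rewrite !(touches_pair _ eE) !inE.
  case: (boolP (i \in B)) => [/(fintype.subsetP BS)->|_];
    case: (boolP (j \in B)) => [/(fintype.subsetP BS)->|_];
    by case: (i \in S); case: (j \in S).
apply: prod_le_two => [e|e|e|e|e].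
- apply: sumr_ge0 => b1 _; apply: sumr_ge0 => b2 _.
  by rewrite mulr_ge0 // pair_weight_ge0 // edge_prob01.
- rewrite inE => eB; have eS : crosses e S by rewrite cutE eB.
  have /andP[tB _] := eB.
  apply: le_trans (light_half_moment theta sigma e); rewrite /phi /cut_ratio eS tB.
  exact: lexx.
- rewrite inE => eA; have eS : crosses e S by rewrite cutE eA orbT.
  have /negPf tB := cut_touch e eA.
  apply: le_trans (union_half_moment sigma e); rewrite /phi /cut_ratio eS tB.
  by under eq_bigr do under eq_bigr do rewrite mulr1.
- by rewrite !inE => /andP[tB _]; apply/negP => /cut_touch; rewrite tB.
rewrite !inE => /negPf eB /negPf eA; rewrite /phi cutE eB eA /=.
under eq_bigr do under eq_bigr do rewrite mulr1.
by rewrite sum_pair_weight.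
Qed.

(** Sets of at most [n / k] vertices are handled by their binomial sum, the
larger ones by their number, at most [2 ^ n]. *)
Lemma misled_prob (K k : nat) (Lam theta A delta z : R) sigma :
  0 < theta -> theta <= 1 -> 1 <= Lam -> Lam <= A -> theta^-1 ^+ K <= A ->
  0 <= delta -> delta <= light_exponent theta -> delta <= union_exponent ->
  (0 < k)%N -> 0 <= z -> z <= 1 ->
  2 * A * expR (- (delta * (n%:R / 2))) <= z ^+ k ->
  cond_prob p q s sigma (misled p q s K Lam sigma) <=
  (1 + 2 * A * expR (- (delta * (n%:R * (1 - k%:R^-1))))) ^+ n - 1 + (2 * z) ^+ n.
Proof.
move=> t0 t1 Lam1 LamA thA d0 dL dU k0 z0 z1 hz.
set x := 2 * A * _.
have A1 : 1 <= A by apply: le_trans Lam1 _.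
have A0 : 0 <= A by apply: le_trans A1.
have x0 : 0 <= x by rewrite !mulr_ge0 // expR_ge0.
have Lam0 : 0 <= Lam by apply: le_trans Lam1.
have th0 : 0 <= theta^-1 by rewrite invr_ge0 ltW.
apply: le_trans (@cond_prob_union R n p q s p01 q01 s01 _
  (fun x : {set 'I_n} * {set 'I_n} => [&& (0 < #|x.1|)%N, (#|x.1|.*2 <= n)%N &
     x.2 \subset x.1]) sigma _
  (fun x X Y =>
    (#|[set e in X :&: Y | touches e x.2 && crosses e x.1]| <= K * #|x.2|)%N /\
    1 <= Lam ^+ #|x.1 :\: x.2| *
       \prod_(e | crosses e x.1) cut_ratio p q s x.2 sigma e (e \in X) (e \in Y)) _) _.
  by move=> X Y [S [B [BS S0 Sn cnt ge1]]]; exists (S, B); rewrite ?S0 ?Sn.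
apply: (@le_trans _ _ (\sum_(S : {set 'I_n} | (0 < #|S|)%N && (#|S|.*2 <= n)%N)
   \sum_(B : {set 'I_n} | B \subset S)
      (A * expR (- (delta * (n%:R - #|S|%:R)))) ^+ #|S|)).
  rewrite [leRHS]pair_big_dep /= (eq_bigl (fun x : {set 'I_n} * {set 'I_n} =>
    ((0 < #|x.1|)%N && (#|x.1|.*2 <= n)%N) && (x.2 \subset x.1))); last first.
    by move=> x'; rewrite andbA.
  apply: ler_sum => -[S B] /= /andP[_ BS].
  apply: le_trans (misled_set_prob K sigma t0 t1 Lam1 BS) _.
  have cS : #|S| = (#|S :\: B| + #|B|)%N.
    by rewrite -(cardsID B S) (setIidPr BS) addnC.
  have cC : #|~: S|%:R = n%:R - #|S|%:R :> R.
    apply/eqP; rewrite eq_sym subr_eq -natrD addnC; apply/eqP; congr (_%:R).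
    by rewrite cardsC card_ord.
  have eL : expR (- light_exponent theta) <= expR (- delta) by rewrite ler_expR lerN2.
  have eU : expR (- union_exponent) <= expR (- delta) by rewrite ler_expR lerN2.
  rewrite exprMn; apply: ler_pM.
  - by rewrite mulr_ge0 // exprn_ge0.
  - by rewrite mulr_ge0 // exprn_ge0 // expR_ge0.
  - rewrite [#|S|]cS exprD exprM; apply: ler_pM.
    + by rewrite exprn_ge0.
    + by rewrite !exprn_ge0.
    + exact: lerXn2r.
    + by rewrite lerXn2r // nnegrE exprn_ge0.
  have -> : expR (- (delta * (n%:R - #|S|%:R))) = expR (- delta) ^+ #|~: S|.
    by rewrite -cC -expRM_natl; congr expR; ring.
  rewrite -exprM [X in _ <= _ ^+ X]mulnC [X in _ <= _ ^+ (X * _)]cS mulnDl addnC exprD.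
  by apply: ler_pM; rewrite ?exprn_ge0 ?expR_ge0 //; apply: lerXn2r;
    rewrite ?nnegrE ?expR_ge0.
apply: (@le_trans _ _ (\sum_(S : {set 'I_n} | (0 < #|S|)%N) x ^+ #|S| +
   \sum_(S : {set 'I_n}) z ^+ n)).
  rewrite big_mkcond [X in _ <= X + _]big_mkcond -big_split /=.
  apply: ler_sum => S _; case: ifP => [/andP[S0 Sn]|_]; last first.
    by case: ifP => _; rewrite addr_ge0 ?exprn_ge0.
  rewrite S0 sumr_const.
  have -> : #|(fun B : {set 'I_n} => B \subset S)| = (2 ^ #|S|)%N.
    by rewrite -card_powerset; apply: eq_card => B; rewrite inE.
  rewrite -[leLHS]mulr_natl natrX -exprMn mulrA.
  have [kS|kS] := leqP (k * #|S|) n.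
    rewrite ler_wpDr ?exprn_ge0 //; apply: lerXn2r; rewrite ?nnegrE ?mulr_ge0 ?expR_ge0 //.
    rewrite /x ler_wpM2l ?mulr_ge0 // ler_expR lerN2 ler_wpM2l //.
    rewrite mulrBr mulr1 lerD2l lerN2 ler_pdivlMr ?ltr0n //.
    by rewrite -natrM ler_nat mulnC.
  rewrite ler_wpDl ?exprn_ge0 //.
  apply: (@le_trans _ _ ((z ^+ k) ^+ #|S|)).
    apply: lerXn2r; rewrite ?nnegrE ?mulr_ge0 ?expR_ge0 ?exprn_ge0 //.
    apply: le_trans hz; rewrite ler_wpM2l ?mulr_ge0 // ler_expR lerN2 ler_wpM2l //.
    have : #|S|%:R * 2 <= n%:R :> R by rewrite -natrM ler_nat muln2.
    by lra.
  by rewrite -exprM; apply: ler_wiXn2l => //; exact: ltnW.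
rewrite sumr_const -cardsT -powersetT card_powerset cardsT card_ord.
rewrite -[_ *+ _]mulr_natl natrX -exprMn lerD2r.
rewrite lerBrDr; have := sum_subset_expr [set: 'I_n] x.
rewrite cardsT card_ord => <-.
rewrite [leRHS](bigID (fun S : {set 'I_n} => (0 < #|S|)%N)) /=.
rewrite (eq_bigl (fun S : {set 'I_n} => (S \subset [set: 'I_n]) && (0 < #|S|)%N)); last first.
  by move=> S; rewrite finset.subsetT.
rewrite lerD2l (bigD1 set0) /=; last by rewrite finset.subsetT cards0.
by rewrite cards0 expr0 lerDl; apply: sumr_ge0 => *; exact: exprn_ge0.
Qed.

End Misled.

(** * The estimator *)

Section Estimator.
Variables (R : realType) (n : nat).

Definition best_match (G1 G2 : graph n) : {perm 'I_n} * {set 'I_n} :=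
  [arg max_(x > (1%g, set0) | kdense 20 (G1 :&: relabel x.1 G2) x.2) #|x.2|].

Definition estimate (p q s : R) (G1 G2 : graph n) : labels n :=
  let: (tau, M) := best_match G1 G2 in
  [arg max_(sigma > [ffun=> true]) score p q s M G1 (relabel tau G2) sigma]%O.

Lemma overlap_eq1 (tau sigma : labels n) : (0 < n)%N ->
  (forall i, tau i = sigma i) \/ (forall i, tau i = ~~ sigma i) ->
  overlap R tau sigma == 1.
Proof.
move=> n0 h; have nR : n%:R != 0 :> R by rewrite pnatr_eq0 -lt0n.
have spinM b : spin R b * spin R b = 1 by case: b; rewrite /= ?mulrNN mulr1.
have spinN b : spin R (~~ b) = - spin R b by case: b; rewrite /= ?opprK.
have [c c1 hc] : exists2 c : R, `|c| = 1 & forall i, spin R (tau i) * spin R (sigma i) = c.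
  case: h => h; first by exists 1; rewrite ?normr1 // => i; rewrite h spinM.
  by exists (-1); rewrite ?normrN1 // => i; rewrite h spinN mulNr spinM.
rewrite /overlap (eq_bigr (fun=> c)) // sumr_const card_ord normrMn c1.
by rewrite mulVf.
Qed.

Variables (p q s : R).
Hypotheses (n0 : (0 < n)%N).
Hypotheses (p0 : 0 < p) (p1 : p < 1) (q0 : 0 < q) (q1 : q < 1).
Hypotheses (s0 : 0 < s) (s1 : s <= 1).
Variables (C0 kap : R).
Hypotheses (pC0 : p <= C0 * q) (qC0 : q <= C0 * p).
Hypotheses (kapE : 1 <= kap * ((1 - p) * (1 - q))).

Definition exceptional (c N : nat) (sigma : labels n) (X Y : graph n) : Prop :=
  (wrong_match 20 X Y \/ crowded c (20 + c) X Y) \/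
  ((N < #|light (20 + c) X Y|)%N \/
   misled p q s (20 + c) (C0 ^+ c * kap ^+ N) sigma X Y).

(** Relabeling the second graph by [pi] only relabels the candidate matchings,
so the analysis may compare [G1] with the unrelabeled second subgraph. *)
Lemma estimate_correct c N sigma G X Y (pi : {perm 'I_n}) :
  ~ exceptional c N sigma X Y ->
  let w : csbm_outcome n := (sigma, G, X, Y, pi) in
  overlap R (estimate p q s (csbm_G1 w) (csbm_G2 w)) (csbm_labels w) == 1.
Proof.
move=> nexc; have [nwm ncr nli nmi] : [/\ ~ wrong_match 20 X Y,
    ~ crowded c (20 + c) X Y, ~ (N < #|light (20 + c) X Y|)%N &
    ~ misled p q s (20 + c) (C0 ^+ c * kap ^+ N) sigma X Y].
  by split=> h; apply: nexc; [left; left|left; right|right; left|right; right].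
rewrite /csbm_G1 /csbm_G2 /csbm_labels /=; apply: overlap_eq1 => //.
rewrite /estimate /best_match; case: arg_maxnP => /=; first exact: kdense0.
move=> [tau M] /= dM maxM; rewrite relabelM in dM *.
have [fixM ML] : {in M, (pi * tau)%g =1 id} /\ ~: M \subset light (20 + c) X Y.
  apply: max_dense_heavy nwm ncr dM _ => M' dM'.
  by apply: (maxM (pi^-1%g, M')); rewrite relabelM mulgV relabel1.
case: arg_maxP => // tau' _ max_tau'.
apply: (score_max_misled p0 p1 q0 q1 s0 s1 pC0 qC0 kapE ML _ ncr _ (max_tau' sigma isT) nmi).
  by rewrite leqNgt; apply/negP.
move=> e eM; apply: mem_relabel_fix => i /(fintype.subsetP eM); exact: fixM.
Qed.

Lemma csbm_error_bound c N (B1 B2 B3 B4 : R) :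
  (forall sigma : labels n, cond_prob p q s sigma (wrong_match 20) <= B1) ->
  (forall sigma : labels n, cond_prob p q s sigma (crowded c (20 + c)) <= B2) ->
  (forall sigma : labels n,
     cond_prob p q s sigma (fun X Y => (N < #|light (20 + c) X Y|)%N) <= B3) ->
  (forall sigma : labels n, cond_prob p q s sigma
     (misled p q s (20 + c) (C0 ^+ c * kap ^+ N) sigma) <= B4) ->
  1 - (B1 + B2 + (B3 + B4)) <= csbm_prob p q s (fun w : csbm_outcome n =>
     overlap R (estimate p q s (csbm_G1 w) (csbm_G2 w)) (csbm_labels w) == 1) <= 1.
Proof.
move=> b1 b2 b3 b4.
have p01 : 0 <= p <= 1 by rewrite !ltW.
have q01 : 0 <= q <= 1 by rewrite !ltW.
have s01 : 0 <= s <= 1 by rewrite s1 ltW.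
apply: (csbm_prob_bounds p01 q01 s01 (bad := exceptional c N)).
  by move=> sigma G X Y pi; exact: estimate_correct.
move=> sigma; apply: le_trans (cond_prob_or p01 q01 s01 _ _ _) _.
by apply: lerD; (apply: le_trans (cond_prob_or p01 q01 s01 _ _ _) _; exact: lerD).
Qed.

End Estimator.

(** * Asymptotics *)
Local Open Scope classical_set_scope.
Local Open Scope ring_scope.

Lemma ln_nat_cvgy (R : realType) : (ln (n%:R : R)) @[n --> \oo] --> +oo.
Proof.
apply/cvgryPge => A; near=> n.
rewrite -[leLHS]expRK ler_ln ?posrE ?expR_gt0 //.
  by apply/ltW; near: n; exact: nbhs_infty_gtr.
by rewrite ltr0n; near: n; exact: nbhs_infty_gt.
Unshelve. all: by end_near. Qed.

Lemma pow_le_expR (R : realType) (j : nat) (a : R) : 0 < a ->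
  exists2 C : R, 0 <= C & forall y : R, 0 <= y -> y ^+ j <= C * expR (a * y).
Proof.
move=> a0; pose b := a / j.+1%:R; have b0 : 0 < b by rewrite divr_gt0.
exists (b^-1 ^+ j); first by rewrite exprn_ge0 // invr_ge0 ltW.
move=> y y0; have yb : y <= b^-1 * expR (b * y).
  rewrite mulrC ler_pdivlMr // mulrC; apply: le_trans (expR_ge1Dx _).
  by rewrite lerDr.
apply: (@le_trans _ _ ((b^-1 * expR (b * y)) ^+ j)).
  by apply: lerXn2r => //; rewrite nnegrE mulr_ge0 ?expR_ge0 // invr_ge0 ltW.
rewrite exprMn ler_wpM2l ?exprn_ge0 ?invr_ge0 ?(ltW b0) // -expRM_natl ler_expR.
rewrite mulrA ler_wpM2r // /b mulrCA ler_piMr ?(ltW a0) //.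
by rewrite ler_pdivrMr // mul1r ler_nat.
Qed.

(** As [n] is the exponential of [ln n], all powers of [n] and of [ln n] in the
error terms combine into this form. *)
Lemma ln_pow_expR_cvg0 (R : realType) (j : nat) (a : R) : 0 < a ->
  ln (n%:R : R) ^+ j * expR (- (a * ln n%:R)) @[n --> \oo] --> 0.
Proof.
move=> a0; have a20 : 0 < a / 2 by rewrite divr_gt0.
have [C C0 hC] := pow_le_expR j a20.
have e0 : expR (- (a / 2 * ln (n%:R : R))) @[n --> \oo] --> 0.
  apply: (@cvg_comp _ _ _ (fun n => a / 2 * ln (n%:R : R)) (fun x => expR (- x)) _ +oo).
    have /cvgryPge lny := @ln_nat_cvgy R.
    apply/cvgryPge => A; apply: filterS (lny (A / (a / 2))) => n.
    by rewrite ler_pdivrMr // mulrC.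
  exact: cvgr_expR.
apply: (@squeeze_cvgr _ _ _ _ (fun=> 0) (fun n => C * expR (- (a / 2 * ln (n%:R : R))))).
- near=> n; have y0 : 0 <= ln (n%:R : R).
    by rewrite ln_ge0 // ler1n; near: n; exact: nbhs_infty_ge.
  rewrite mulr_ge0 ?exprn_ge0 ?expR_ge0 //=.
  apply: le_trans (ler_wpM2r (expR_ge0 _) (hC _ y0)) _.
  have -> : - (a / 2 * ln (n%:R : R)) = a / 2 * ln n%:R + - (a * ln n%:R) by lra.
  by rewrite expRD mulrA.
- exact: cvg_cst.
- rewrite -[X in _ --> X](mulr0 C); apply: cvgM => //; exact: cvg_cst.
Unshelve. all: by end_near. Qed.

Lemma expR_sub1_cvg0 (R : realType) (f : nat -> R) :
  f n @[n --> \oo] --> 0 -> expR (f n) - 1 @[n --> \oo] --> 0.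
Proof.
move=> f0; rewrite -[X in _ --> X](subrr 1) -expR0; apply: cvgB; last exact: cvg_cst.
exact: (cvg_comp _ _ f0 (@continuous_expR R 0)).
Qed.

Section Densities.
Variable R : realType.

Lemma natE_expR_ln n : (0 < n)%N -> n%:R = expR (ln n%:R) :> R.
Proof. by move=> n0; rewrite lnK // posrE ltr0n. Qed.

Lemma log_densityE (a : R) n : (0 < n)%N ->
  log_density a n = a * (ln n%:R * expR (- ln n%:R)).
Proof. by move=> n0; rewrite /log_density expRN -natE_expR_ln // mulrA. Qed.

Lemma log_density_cvg0 (a : R) : log_density a n @[n --> \oo] --> 0.
Proof.
have h := @ln_pow_expR_cvg0 R 1 1 ltr01.
have : a * (ln (n%:R : R) ^+ 1 * expR (- (1 * ln n%:R))) @[n --> \oo] --> a * 0.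
  by apply: cvgM => //; exact: cvg_cst.
rewrite mulr0; apply: cvg_trans; apply: near_eq_cvg; near=> n.
rewrite expr1 mul1r log_densityE //; near: n; exact: nbhs_infty_gt.
Unshelve. all: by end_near. Qed.

Lemma log_density_small (a e : R) : 0 < a -> 0 < e ->
  \forall n \near \oo, 0 < log_density a n < e.
Proof.
move=> a0 e0; have /cvgr0Pnorm_lt/(_ e e0) := @log_density_cvg0 a.
apply: filterS2 (nbhs_infty_gt 1%N) => n n1 h.
have -> : 0 < log_density a n.
  by rewrite /log_density divr_gt0 ?mulr_gt0 ?ln_gt0 ?ltr1n ?ltr0n // ltnW.
by apply: le_lt_trans h; exact: ler_norm.
Qed.

Lemma max_log_density (a b : R) n : (0 < n)%N ->
  Num.max (log_density a n) (log_density b n) = log_density (Num.max a b) n.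
Proof.
move=> n0; rewrite /log_density -!mulrA maxr_pMl // divr_ge0 //.
by rewrite ln_ge0 // ler1n.
Qed.

Lemma min_log_density (a b : R) n : (0 < n)%N ->
  Num.min (log_density a n) (log_density b n) = log_density (Num.min a b) n.
Proof.
move=> n0; rewrite /log_density -!mulrA minr_pMl // divr_ge0 //.
by rewrite ln_ge0 // ler1n.
Qed.

End Densities.

(** * The error terms vanish *)

Section ErrorTerms.
Variable R : realType.
Implicit Types (alpha beta s a b : R).

Lemma cvg_cst_mul0 (C : R) (f : nat -> R) :
  f n @[n --> \oo] --> 0 -> C * f n @[n --> \oo] --> 0.
Proof. by move=> f0; rewrite -[X in _ --> X](mulr0 C); apply: cvgM => //; exact: cvg_cst. Qed.

Lemma exp_succ_le_expR (x : R) n : 0 <= x -> (1 + x) ^+ n <= expR (n%:R * x).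
Proof.
move=> x0; rewrite expRM_natl; apply: lerXn2r; rewrite ?nnegrE ?expR_ge0 ?addr_ge0 //.
exact: expR_ge1Dx.
Qed.

Lemma natM_expRN n : (0 < n)%N -> n%:R * expR (- ln n%:R) = 1 :> R.
Proof. by move=> n0; rewrite {1}(natE_expR_ln R n0) -expRD subrr expR0. Qed.

Lemma DplusE alpha beta : 0 <= alpha -> 0 <= beta ->
  Dplus alpha beta = (alpha + beta) / 2 - Num.sqrt (alpha * beta).
Proof.
move=> a0 b0; rewrite /Dplus expr_div_n sqr_sqrtr // sqrrB !sqr_sqrtr // sqrtrM //.
by rewrite -mulr_natr; field.
Qed.

Lemma wrong_match_small alpha beta s : 0 < alpha -> 0 < beta -> 0 <= s <= 1 ->
  exists2 B : nat -> R, B n @[n --> \oo] --> 0 &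
    \forall n \near \oo, forall sigma : labels n,
      cond_prob (log_density alpha n) (log_density beta n) s sigma (wrong_match 20) <= B n.
Proof.
move=> a0 b0 s01; set g := Num.max alpha beta.
have g0 : 0 < g by rewrite lt_max a0.
exists (fun n => expR (expR 1 * g ^+ 6 * (ln n%:R ^+ 6 * expR (- (1 * ln n%:R)))) - 1).
  by apply: expR_sub1_cvg0; apply: cvg_cst_mul0; exact: ln_pow_expR_cvg0.
have /cvgr0Pnorm_lt/(_ 1 ltr01) small :=
  cvg_cst_mul0 (g ^+ 2) (@ln_pow_expR_cvg0 R 2 1 ltr01).
near=> n => sigma.
have n0 : (0 < n)%N by near: n; exact: nbhs_infty_gt.
have /andP[p0 p1] : 0 < log_density alpha n < 1.
  by near: n; apply: log_density_small.
have /andP[q0 q1] : 0 < log_density beta n < 1.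
  by near: n; apply: log_density_small.
have small_n : `|g ^+ 2 * (ln (n%:R : R) ^+ 2 * expR (- (1 * ln n%:R)))| < 1.
  by near: n.
have p01 : 0 <= log_density alpha n <= 1 by rewrite !ltW.
have q01 : 0 <= log_density beta n <= 1 by rewrite !ltW.
have nE := natM_expRN n0; rewrite mul1r in small_n *.
set L := ln n%:R in nE small_n *; set E := expR (- L) in nE small_n *.
have pmaxE : Num.max (log_density alpha n) (log_density beta n) = g * (L * E).
  by rewrite max_log_density // log_densityE.
have npE : n%:R * (g * (L * E)) ^+ 2 = g ^+ 2 * (L ^+ 2 * E).
  have -> : n%:R * (g * (L * E)) ^+ 2 = (n%:R * E) * (g ^+ 2 * (L ^+ 2 * E)) by ring.
  by rewrite nE mul1r.
apply: le_trans (@wrong_match_prob R n _ _ s p01 q01 s01 sigma n0 _ _) _.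
- by rewrite lt_max p0.
- by rewrite pmaxE npE; apply: le_trans (ler_norm _) (ltW small_n).
rewrite lerD2r pmaxE npE; apply: le_trans (exp_succ_le_expR _ _) _.
  rewrite mulr_ge0 // mulr_ge0 ?expR_ge0 // exprn_ge0 // mulr_ge0 ?sqr_ge0 //.
  by rewrite mulr_ge0 ?sqr_ge0 // expR_ge0.
rewrite ler_expR; rewrite le_eqVlt; apply/orP; left; apply/eqP.
have -> : n%:R * (n%:R * (expR 1 * (g ^+ 2 * (L ^+ 2 * E)) ^+ 3)) =
  (n%:R * E) * (n%:R * E) * (expR 1 * g ^+ 6 * (L ^+ 6 * E)) by ring.
by rewrite nE !mul1r.
Unshelve. all: by end_near. Qed.

Lemma crowded_small alpha beta s (c K : nat) : 0 < alpha -> 0 < beta -> 0 <= s <= 1 ->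
  2 <= c%:R * (s ^+ 2 * Num.min alpha beta / 4) ->
  exists2 B : nat -> R, B n @[n --> \oo] --> 0 &
    \forall n \near \oo, forall sigma : labels n,
      cond_prob (log_density alpha n) (log_density beta n) s sigma (crowded c K) <= B n.
Proof.
move=> a0 b0 s01 hc; set g := Num.max alpha beta; set m := Num.min alpha beta in hc.
have g0 : 0 < g by rewrite lt_max a0.
have m0 : 0 < m by rewrite lt_min a0.
exists (fun n => 2 ^+ (K * c) * g ^+ c * (ln n%:R ^+ c * expR (- (1 * ln n%:R)))).
  by apply: cvg_cst_mul0; exact: ln_pow_expR_cvg0.
near=> n => sigma.
have n0 : (0 < n)%N by near: n; exact: nbhs_infty_gt.
have cn : (2 * c.+1 <= n)%N by near: n; exact: nbhs_infty_ge.
have /andP[p0 p1] : 0 < log_density alpha n < 1.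
  by near: n; apply: log_density_small.
have /andP[q0 q1] : 0 < log_density beta n < 1.
  by near: n; apply: log_density_small.
have p01 : 0 <= log_density alpha n <= 1 by rewrite !ltW.
have q01 : 0 <= log_density beta n <= 1 by rewrite !ltW.
have nE := natM_expRN n0; have nL := natE_expR_ln R n0.
have cn' : (c < n)%N by move: cn; clear; lia.
apply: le_trans (@crowded_prob R n _ _ s p01 q01 s01 sigma c K cn') _.
rewrite max_log_density // min_log_density // !log_densityE // -/g -/m mul1r.
have L0 : 0 <= ln (n%:R : R) by rewrite ln_ge0 // ler1n.
set L := ln n%:R in L0 nE nL *; set E := expR (- L) in nE *.
have E0 : 0 <= E by exact: expR_ge0.
have decay : expR (- (s ^+ 2 * (m * (L * E)) / 2)) ^+ (c * (n - c.+1)) <= expR (- (2 * L)).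
  rewrite -expRM_natl ler_expR mulrN lerN2.
  have half : n%:R / 2 <= (n - c.+1)%:R :> R.
    rewrite ler_pdivrMr // -natrM ler_nat; move: cn; clear; lia.
  have t0 : 0 <= s ^+ 2 * (m * (L * E)) / 2.
    by rewrite divr_ge0 // mulr_ge0 ?sqr_ge0 // mulr_ge0 ?(ltW m0) // mulr_ge0.
  apply: (@le_trans _ _ ((c%:R * (n%:R / 2)) * (s ^+ 2 * (m * (L * E)) / 2))).
    have -> : c%:R * (n%:R / 2) * (s ^+ 2 * (m * (L * E)) / 2) =
      (n%:R * E) * (c%:R * (s ^+ 2 * m / 4) * L) by field.
    by rewrite nE mul1r ler_wpM2r.
  by rewrite natrM ler_wpM2r // ler_wpM2l.
have -> : n%:R * n%:R ^+ c * (2 ^+ (K * c) * ((g * (L * E)) ^+ c *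
    expR (- (s ^+ 2 * (m * (L * E)) / 2)) ^+ (c * (n - c.+1)))) =
  (n%:R * E) ^+ c * (2 ^+ (K * c) * g ^+ c * L ^+ c) *
    (n%:R * expR (- (s ^+ 2 * (m * (L * E)) / 2)) ^+ (c * (n - c.+1))).
  by rewrite !exprMn; ring.
rewrite nE expr1n mul1r [leRHS]mulrA ler_wpM2l //.
  by rewrite mulr_ge0 ?exprn_ge0 // mulr_ge0 ?exprn_ge0 // ltW.
rewrite {1}nL; apply: le_trans (ler_wpM2l (expR_ge0 _) decay) _.
by rewrite -expRD /E ler_expR; lra.
Unshelve. all: by end_near. Qed.

Lemma many_light_small alpha beta s (K d : nat) : 0 < alpha -> 0 < beta ->
  0 < s -> s <= 1 -> (0 < d)%N ->
  exists2 B : nat -> R, B n @[n --> \oo] --> 0 &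
    \forall n \near \oo, forall sigma : labels n,
      cond_prob (log_density alpha n) (log_density beta n) s sigma
        (fun X Y => (n %/ d < #|light K X Y|)%N) <= B n.
Proof.
move=> a0 b0 s0 s1 d0; set m := Num.min alpha beta.
have s01 : 0 <= s <= 1 by rewrite s1 ltW.
have m0 : 0 < m by rewrite lt_min a0.
pose e := s ^+ 2 * m / 4.
have e0 : 0 < e by rewrite divr_gt0 // mulr_gt0 // exprn_gt0.
exists (fun n => d%:R * 2 ^+ K * (ln n%:R ^+ 0 * expR (- (e * ln n%:R)))).
  by apply: cvg_cst_mul0; exact: ln_pow_expR_cvg0.
near=> n => sigma.
have n2 : (2 <= n)%N by near: n; exact: nbhs_infty_ge.
have n0 : (0 < n)%N by apply: ltnW.
have /andP[p0 p1] : 0 < log_density alpha n < 1.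
  by near: n; apply: log_density_small.
have /andP[q0 q1] : 0 < log_density beta n < 1.
  by near: n; apply: log_density_small.
have p01 : 0 <= log_density alpha n <= 1 by rewrite !ltW.
have q01 : 0 <= log_density beta n <= 1 by rewrite !ltW.
have nE := natM_expRN n0.
have Nn : n%:R <= (n %/ d).+1%:R * d%:R :> R.
  by rewrite -natrM ler_nat ltnW // -ltn_divLR.
rewrite -(ler_pM2l (_ : 0 < (n %/ d).+1%:R)) ?ltr0n //.
apply: le_trans (@many_light_prob R n _ _ s p01 q01 s01 sigma K (n %/ d)) _.
rewrite min_log_density // log_densityE // -/m expr0 mul1r.
have L0 : 0 <= ln (n%:R : R) by rewrite ln_ge0 // ler1n.
set L := ln n%:R in L0 nE *; set E := expR (- L) in nE *.
have E0 : 0 <= E by exact: expR_ge0.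
rewrite [leRHS](_ : _ = (n %/ d).+1%:R * d%:R * (2 ^+ K * expR (- (e * L)))); last by ring.
apply: ler_pM => //.
rewrite ler_wpM2l ?exprn_ge0 // -expRM_natl ler_expR mulrN lerN2.
have half : n%:R / 2 <= n.-1%:R :> R.
  by rewrite ler_pdivrMr // -natrM ler_nat; move: n2; clear; lia.
apply: (@le_trans _ _ (n%:R / 2 * (s ^+ 2 * (m * (L * E)) / 2))); last first.
  apply: ler_wpM2r half; rewrite divr_ge0 // mulr_ge0 ?sqr_ge0 //.
  by rewrite mulr_ge0 ?(ltW m0) // mulr_ge0.
have -> : n%:R / 2 * (s ^+ 2 * (m * (L * E)) / 2) = (n%:R * E) * (e * L).
  by rewrite /e; field.
by rewrite nE mul1r.
Unshelve. all: by end_near. Qed.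

(** As long as few vertices are flipped, each costs a factor n^(- 1 - 4 * eta),
whether it is matched or not. Three losses of at most [eta] each are affordable: the tilt [theta] of the
common edges, the light vertices, at most a fraction [1 / d] of all, and the
size of the flipped set, up to a fraction [1 / k] of all vertices. *)
Lemma misled_small alpha beta s eta (c d : nat) : 0 < alpha -> 0 < beta ->
  0 < s -> s <= 1 -> 0 < eta -> (0 < d)%N ->
  1 + 4 * eta <= s ^+ 2 * Tc alpha beta + s * (1 - s) * Dplus alpha beta ->
  1 + 4 * eta <= (1 - (1 - s) ^+ 2) * Dplus alpha beta ->
  4 * Num.max alpha beta / d%:R <= eta ->
  exists2 B : nat -> R, B n @[n --> \oo] --> 0 &
    \forall n \near \oo, forall sigma : labels n,
      cond_prob (log_density alpha n) (log_density beta n) s sigma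
        (misled (log_density alpha n) (log_density beta n) s (20 + c)
           ((alpha / beta + beta / alpha) ^+ c *
            expR (4 * log_density (Num.max alpha beta) n) ^+ (n %/ d)) sigma) <= B n.
Proof.
move=> a0 b0 s0 s1 eta0 d0 hD1 hD2 hd; set g := Num.max alpha beta in hd *.
have g0 : 0 < g by rewrite lt_max a0.
set C0 := alpha / beta + beta / alpha.
set K := (20 + c)%N.
pose Q := s ^+ 2 * Num.sqrt (alpha * beta).
have Q0 : 0 <= Q by rewrite mulr_ge0 ?sqr_ge0 // sqrtr_ge0.
(* At most 1, and theta * Q <= eta even if Q is small. *)
pose theta := eta / (eta + Q).
have eQ0 : 0 < eta + Q by rewrite ltr_wpDr.
have t0 : 0 < theta by rewrite divr_gt0.
have t1 : theta <= 1 by rewrite ler_pdivrMr // mul1r lerDl.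
have tQ : theta * Q <= eta.
  by rewrite /theta mulrAC ler_pdivrMr // ler_wpM2l ?(ltW eta0) // lerDr ltW.
have C00 : 0 <= C0 by rewrite addr_ge0 // divr_ge0 // ltW.
have th0 : 0 <= theta^-1 by rewrite invr_ge0 ltW.
pose C1 := C0 ^+ c + theta^-1 ^+ K.
have C0C1 : C0 ^+ c <= C1 by rewrite lerDl exprn_ge0.
have thC1 : theta^-1 ^+ K <= C1 by rewrite lerDr exprn_ge0.
have C10 : 0 <= C1 by rewrite addr_ge0 // exprn_ge0.
have [k k0 hk] : exists2 k : nat, (0 < k)%N & (1 + 3 * eta) / k%:R <= eta.
  have r0 : 0 <= (1 + 3 * eta) / eta.
    by rewrite divr_ge0 ?(ltW eta0) // addr_ge0 // mulr_ge0 // ltW.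
  have hb := archi_boundP r0; exists (Num.bound ((1 + 3 * eta) / eta)).
    by rewrite -(ltr0n R); apply: le_lt_trans hb.
  rewrite ler_pdivrMr; last by apply: le_lt_trans hb.
  by rewrite [eta * _]mulrC; move: hb; rewrite ltr_pdivrMr // => /ltW.
exists (fun n => expR (2 * C1 * (ln n%:R ^+ 0 * expR (- (eta * ln n%:R)))) - 1 +
    (2 * 4^-1) ^+ n).
  rewrite -[X in _ --> X](addr0 0); apply: cvgD.
    by apply: expR_sub1_cvg0; apply: cvg_cst_mul0; exact: ln_pow_expR_cvg0.
  apply: cvg_expr; rewrite ger0_norm ?mulr_ge0 ?invr_ge0 //.
  by rewrite ltr_pdivrMr // mul1r ltr_nat.
have e20 : 0 < (1 + eta) / 2 by rewrite divr_gt0 // addr_gt0.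
have z0 : 0 < (4^-1 : R) ^+ k by rewrite exprn_gt0 // invr_gt0.
have /cvgr0Pnorm_lt/(_ _ z0) small :=
  cvg_cst_mul0 (2 * C1) (@ln_pow_expR_cvg0 R 0 _ e20).
near=> n => sigma.
have n0 : (0 < n)%N by near: n; exact: nbhs_infty_gt.
have /andP[p0 p1] : 0 < log_density alpha n < 1.
  by near: n; apply: log_density_small.
have /andP[q0 q1] : 0 < log_density beta n < 1.
  by near: n; apply: log_density_small.
have small_n : `|2 * C1 * (ln (n%:R : R) ^+ 0 * expR (- ((1 + eta) / 2 * ln n%:R)))|
    < 4^-1 ^+ k.
  by near: n.
have nE := natM_expRN n0; have nL := natE_expR_ln R n0.
have L0 : 0 <= ln (n%:R : R) by rewrite ln_ge0 // ler1n.
rewrite expr0 !mul1r in small_n *.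
rewrite [log_density g n]log_densityE //.
have pE := log_densityE alpha n0; have qE := log_densityE beta n0.
set p := log_density alpha n in p0 p1 pE *; set q := log_density beta n in q0 q1 qE *.
set L := ln n%:R in L0 nE nL pE qE small_n *; set E := expR (- L) in nE pE qE *.
have E0 : 0 <= E by exact: expR_ge0.
set t := L * E in pE qE *; have t_ge0 : 0 <= t by rewrite mulr_ge0.
have nt : n%:R * t = L by rewrite /t mulrCA nE mulr1.
have pq : p <= C0 * q.
  rewrite pE qE mulrA ler_wpM2r // /C0 mulrDl divfK ?lt0r_neq0 // lerDl.
  by rewrite mulr_ge0 ?divr_ge0 // ltW.
have qp : q <= C0 * p.
  rewrite pE qE mulrA ler_wpM2r // /C0 mulrDl [beta / alpha * _]divfK ?lt0r_neq0 // lerDr.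
  by rewrite mulr_ge0 ?divr_ge0 // ltW.
have C0_1 := C0_ge1 p0 q0 pq qp.
have sqrtpq : Num.sqrt (p * q) = Num.sqrt (alpha * beta) * t.
  rewrite pE qE mulrACA sqrtrM ?mulr_ge0 ?(ltW a0) ?(ltW b0) //.
  by rewrite -expr2 sqrtr_sqr ger0_norm.
have eN : expR (4 * (g * t)) ^+ (n %/ d) <= expR (eta * L).
  rewrite -expRM_natl ler_expR.
  have Nd : (n %/ d)%:R <= n%:R / d%:R :> R.
    by rewrite ler_pdivlMr ?ltr0n // -natrM ler_nat leq_divM.
  apply: (@le_trans _ _ (n%:R / d%:R * (4 * (g * t)))).
    by rewrite ler_wpM2r // mulr_ge0 // mulr_ge0 // ltW.
  have -> : n%:R / d%:R * (4 * (g * t)) = 4 * g / d%:R * (n%:R * t) by ring.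
  by rewrite nt ler_wpM2r.
have e_eta : 1 <= expR (eta * L).
  by rewrite -expR0 ler_expR mulr_ge0 // ltW.
pose A := C1 * expR (eta * L).
apply: le_trans (@misled_prob R n p q s p0 p1 q0 q1 s0 s1 K k _ theta A
  ((1 + 3 * eta) * t) 4^-1 sigma t0 t1 _ _ _ _ _ _ k0 _ _ _) _.
- by rewrite mulr_ege1 // exprn_ege1 // -expR0 ler_expR mulr_ge0 // mulr_ge0 // ltW.
- by rewrite /A; apply: ler_pM => //; rewrite exprn_ge0 // expR_ge0.
- by rewrite /A; apply: le_trans thC1 _; rewrite ler_peMr.
- by rewrite mulr_ge0 // addr_ge0 // mulr_ge0 // ltW.
- rewrite /light_exponent sqrtpq pE qE.
  have -> : s * (alpha * t + beta * t) / 2 -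
      (s * (1 - s) + theta * s ^+ 2) * (Num.sqrt (alpha * beta) * t) =
    (s ^+ 2 * Tc alpha beta +
     s * (1 - s) * ((alpha + beta) / 2 - Num.sqrt (alpha * beta)) - theta * Q) * t.
    by rewrite /Tc /Q; field.
  rewrite -DplusE ?(ltW a0) ?(ltW b0) // ler_wpM2r //.
  by move: hD1 tQ; lra.
- rewrite /union_exponent sqrtpq pE qE.
  have -> : union_rate s * ((alpha * t + beta * t) / 2 - Num.sqrt (alpha * beta) * t) =
    (1 - (1 - s) ^+ 2) * ((alpha + beta) / 2 - Num.sqrt (alpha * beta)) * t.
    by rewrite /union_rate; field.
  rewrite -DplusE ?(ltW a0) ?(ltW b0) // ler_wpM2r //.
  by move: hD2 eta0; lra.
- by rewrite invr_ge0.
- by rewrite invf_le1 // ler1n.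
- apply: le_trans (le_trans (ler_norm _) (ltW small_n)).
  rewrite /A mulrA -mulrA -expRD ler_wpM2l ?mulr_ge0 // ler_expR.
  have -> : (1 + 3 * eta) * t * (n%:R / 2) = (1 + 3 * eta) * (n%:R * t) / 2 by ring.
  by rewrite nt; lra.
rewrite lerD2r lerD2r; apply: le_trans (exp_succ_le_expR _ _) _.
  by rewrite !mulr_ge0 ?expR_ge0.
rewrite ler_expR.
have -> : (1 + 3 * eta) * t * (n%:R * (1 - k%:R^-1)) =
  (1 + 3 * eta) * (1 - k%:R^-1) * L by rewrite -nt; ring.
set w := expR (- ((1 + 3 * eta) * _ * L)).
have -> : n%:R * (2 * A * w) = 2 * C1 * (expR L * expR (eta * L) * w).
  by rewrite -nL /A; ring.
rewrite ler_wpM2l ?mulr_ge0 // -!expRD ler_expR.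
have : (1 + 3 * eta) / k%:R * L <= eta * L by rewrite ler_wpM2r.
lra.
Unshelve. all: by end_near. Qed.

Lemma one_sub_ge_expR (x : R) : 0 <= x -> x <= 1 / 2 -> expR (- (2 * x)) <= 1 - x.
Proof.
move=> x0 x2; have e0 := expR_gt0 (2 * x).
have e1 : 1 + 2 * x <= expR (2 * x) by exact: expR_ge1Dx.
rewrite expRN -[leLHS]mul1r ler_pdivrMr //.
apply: (@le_trans _ _ ((1 - x) * (1 + 2 * x))); first by nra.
by rewrite ler_wpM2l // subr_ge0; lra.
Qed.

End ErrorTerms.

(** * Exact recovery *)

Lemma exists_nat_ge (R : realType) (x : R) : exists2 k : nat, (0 < k)%N & x <= k%:R.
Proof.
exists (Num.bound `|x|).+1 => //; apply: le_trans (ler_norm x) _.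
by apply: le_trans (ltW (archi_boundP (normr_ge0 x))) _; rewrite ler_nat.
Qed.

Theorem theorem1p1 (R : realType) (alpha beta s : R)
    (alpha_gt0 : 0 < alpha) (beta_gt0 : 0 < beta)
    (s_ge0 : 0 <= s) (s_le1 : s <= 1)
    (union_cond : 1 < (1 - (1 - s) ^+ 2) * Dplus alpha beta)
    (inter_cond : 1 < s ^+ 2 * Tc alpha beta + s * (1 - s) * Dplus alpha beta) :
  exists est : forall n : nat, graph n -> graph n -> labels n,
    csbm_prob (log_density alpha n) (log_density beta n) s
      (fun w : csbm_outcome n =>
         overlap R (est n (csbm_G1 w) (csbm_G2 w)) (csbm_labels w) == 1)
      @[n --> \oo] --> (1 : R).
Proof.
have s_gt0 : 0 < s.
  rewrite lt_neqAle s_ge0 andbT; apply: contraTneq union_cond => <-.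
  by rewrite subr0 expr1n subrr mul0r ltr10.
have s01 : 0 <= s <= 1 by rewrite s_ge0.
pose D := Num.min (s ^+ 2 * Tc alpha beta + s * (1 - s) * Dplus alpha beta)
                  ((1 - (1 - s) ^+ 2) * Dplus alpha beta).
have D1 : 1 < D by rewrite lt_min inter_cond.
pose eta := (D - 1) / 4.
have eta_gt0 : 0 < eta by rewrite divr_gt0 // subr_gt0.
have etaD : 1 + 4 * eta = D by rewrite /eta; field.
set g := Num.max alpha beta; set m := Num.min alpha beta.
have g_gt0 : 0 < g by rewrite lt_max alpha_gt0.
have m_gt0 : 0 < m by rewrite lt_min alpha_gt0.
have e_gt0 : 0 < s ^+ 2 * m / 4 by rewrite divr_gt0 // mulr_gt0 // exprn_gt0.
have [c _ hc] := exists_nat_ge (2 / (s ^+ 2 * m / 4)).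
have [d d_gt0 hd] := exists_nat_ge (4 * g / eta).
have hc' : 2 <= c%:R * (s ^+ 2 * m / 4) by move: hc; rewrite ler_pdivrMr.
have hd' : 4 * g / d%:R <= eta.
  by rewrite ler_pdivrMr ?ltr0n // [eta * _]mulrC -ler_pdivrMr.
have [B1 B1_0 hB1] := wrong_match_small alpha_gt0 beta_gt0 s01.
have [B2 B2_0 hB2] := crowded_small (20 + c) alpha_gt0 beta_gt0 s01 hc'.
have [B3 B3_0 hB3] := many_light_small (20 + c) alpha_gt0 beta_gt0 s_gt0 s_le1 d_gt0.
have hD1 : 1 + 4 * eta <= s ^+ 2 * Tc alpha beta + s * (1 - s) * Dplus alpha beta.
  by rewrite etaD ge_min lexx.
have hD2 : 1 + 4 * eta <= (1 - (1 - s) ^+ 2) * Dplus alpha beta.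
  by rewrite etaD ge_min lexx orbT.
have [B4 B4_0 hB4] := misled_small c alpha_gt0 beta_gt0 s_gt0 s_le1 eta_gt0 d_gt0
  hD1 hD2 hd'.
exists (fun n => estimate (log_density alpha n) (log_density beta n) s).
apply: (@squeeze_cvgr _ _ _ _ (fun n => 1 - (B1 n + B2 n + (B3 n + B4 n))) (fun=> 1)).
- near=> n.
  have n_gt0 : (0 < n)%N by near: n; exact: nbhs_infty_gt.
  have half : 0 < 1 / 2 :> R by rewrite divr_gt0.
  have /andP[p0 p2] : 0 < log_density alpha n < 1 / 2.
    by near: n; exact: log_density_small.
  have /andP[q0 q2] : 0 < log_density beta n < 1 / 2.
    by near: n; exact: log_density_small.
  have p1 : log_density alpha n < 1 by move: p2; lra.
  have q1 : log_density beta n < 1 by move: q2; lra.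
  have t_ge0 : 0 <= ln n%:R * expR (- ln n%:R) :> R.
    by rewrite mulr_ge0 ?expR_ge0 // ln_ge0 // ler1n.
  have pE := log_densityE alpha n_gt0; have qE := log_densityE beta n_gt0.
  set t := ln n%:R * expR (- ln n%:R) in t_ge0 pE qE.
  apply: (@csbm_error_bound R n _ _ s n_gt0 p0 p1 q0 q1 s_gt0 s_le1
    (alpha / beta + beta / alpha) (expR (4 * log_density g n)) _ _ _ c (n %/ d)).
  + rewrite pE qE mulrA ler_wpM2r // mulrDl divfK ?lt0r_neq0 // lerDl.
    by rewrite mulr_ge0 ?divr_ge0 // ltW.
  + rewrite pE qE mulrA ler_wpM2r // mulrDl [beta / alpha * _]divfK ?lt0r_neq0 //.
    by rewrite lerDr mulr_ge0 ?divr_ge0 // ltW.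
  + apply: (@le_trans _ _ (expR (4 * log_density g n) *
      (expR (- (2 * log_density alpha n)) * expR (- (2 * log_density beta n))))).
      rewrite -!expRD -[leLHS]expR0 ler_expR -max_log_density //.
      have pm : log_density alpha n <= Num.max (log_density alpha n) (log_density beta n).
        by rewrite le_max lexx.
      have qm : log_density beta n <= Num.max (log_density alpha n) (log_density beta n).
        by rewrite le_max lexx orbT.
      by move: pm qm; lra.
    rewrite ler_wpM2l ?expR_ge0 //; apply: ler_pM; rewrite ?expR_ge0 //.
      by apply: one_sub_ge_expR; exact: ltW.
    by apply: one_sub_ge_expR; exact: ltW.
  + by near: n.
  + by near: n.
  + by near: n.
  + by near: n.
- rewrite -[X in _ --> X]subr0; apply: cvgB; first exact: cvg_cst.
  rewrite -[X in _ --> X]addr0; apply: cvgD; rewrite -[X in _ --> X]addr0; exact: cvgD.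
- exact: cvg_cst.
Unshelve. all: by end_near. Qed.
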